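(* Let $s>0$ and let $f$ be a proper log-concave function on $\mathbb{R}^d$. Then there exists a unique John $s$-ellipsoid of $f$; that is, among all $d$-symmetric ellipsoids $\overline{E}\subset\mathbb{R}^{d+1}$ contained in the $s$-lifting ${}^{(s)}\overline{f}$ of $f$, there is exactly one of maximal $s$-volume.
   Context: A function $f:\mathbb{R}^d\to[0,\infty)$ is log-concave if $f=e^{-\psi}$ for some convex $\psi:\mathbb{R}^d\to\mathbb{R}\cup\{\infty\}$; it is proper log-concave if moreover it is upper semi-continuous and has finite positive integral. Identify $\mathbb{R}^d$ with the hyperplane of $\mathbb{R}^{d+1}$ spanned by the first $d$ basis vectors; a set in $\mathbb{R}^{d+1}$ is $d$-symmetric if it is symmetric under reflection in $\mathbb{R}^d$. The $s$-lifting of $f$ is ${}^{(s)}\overline{f}=\{(x,\xi)\in\mathbb{R}^{d+1}: |\xi|\le f(x)^{1/s}\}$. The $s$-volume of a $d$-symmetric Borel set $\overline{C}\subset\mathbb{R}^{d+1}$ is ${}^{(s)}\mu(\overline{C})=\int_{\mathbb{R}^d}\left[\tfrac12\mathrm{length}(\overline{C}\cap\ell_x)\right]^s\,dx$, where $\ell_x$ is the line perpendicular to $\mathbb{R}^d$ at $x$. The $d$-symmetric ellipsoids are exactly the sets $(A\oplus\alpha)\mathbf{B}^{d+1}+a$, with $A\in\mathbb{R}^{d\times d}$ positive definite, $\alpha>0$, $a\in\mathbb{R}^d$, where $A\oplus\alpha$ is the block-diagonal $(d+1)\times(d+1)$ matrix and $\mathbf{B}^{d+1}$ is the Euclidean unit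 ball. A John $s$-ellipsoid of $f$ is a $d$-symmetric ellipsoid contained in ${}^{(s)}\overline{f}$ whose $s$-volume is the maximum over all such ellipsoids. *)

(* Defs.v *)
From HB Require Import structures.
From mathcomp Require Import all_boot all_order all_algebra.
From mathcomp Require Import all_classical all_reals all_analysis.
Set Implicit Arguments.
Unset Strict Implicit.
Unset Printing Implicit Defensive.
Import Order.TTheory GRing.Theory Num.Theory.
Import numFieldNormedType.Exports.
Local Open Scope classical_set_scope.
Local Open Scope ring_scope.

Section tuple_product.
Context d (T : measurableType d) (R : realType) (n : nat).
Variable m1 : {sigma_finite_measure set T -> \bar R}.
Variable m2 : {sigma_finite_measure set (n.-tuple T) -> \bar R}.

Definition tcons (p : T * n.-tuple T) : n.+1.-tuple T := [tuple of p.1 :: p.2].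

Lemma measurable_tcons : measurable_fun setT tcons.
Proof. exact: measurable_cons. Qed.

(* The product of m1 and m2, transported from T * T^n to T^(n+1). *)
Definition tuple_product : set (n.+1.-tuple T) -> \bar R :=
  pushforward (m1 \x m2)%E tcons.

Let tuple_product0 : tuple_product set0 = 0%E.
Proof. by rewrite /tuple_product /pushforward preimage_set0 measure0. Qed.

Let tuple_product_ge0 A : (0 <= tuple_product A)%E.
Proof. by rewrite /tuple_product /pushforward; exact: measure_ge0. Qed.

Let tuple_product_sigma_additive : semi_sigma_additive tuple_product.
Proof.
move=> F mF tF mUF; rewrite /tuple_product /pushforward preimage_bigcup.
apply: measure_semi_sigma_additive.
- by move=> k; rewrite -[X in measurable X]setTI; exact: measurable_tcons.
- apply/trivIsetP => /= i j _ _ ij; rewrite -preimage_setI.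
  by move/trivIsetP : tF => /(_ _ _ _ _ ij) ->//; rewrite preimage_set0.
- by rewrite -preimage_bigcup -[X in measurable X]setTI; exact: measurable_tcons.
Qed.

HB.instance Definition _ := isMeasure.Build _ _ _ tuple_product
  tuple_product0 tuple_product_ge0 tuple_product_sigma_additive.

Let tuple_product_sigma_finite : sigma_finite setT tuple_product.
Proof.
have /sigma_finiteP[F [TF ndF Foo]] := sigma_finiteT m1.
have /sigma_finiteP[G [TG ndG Goo]] := sigma_finiteT m2.
pose H k : set (n.+1.-tuple T) :=
  (fun t : n.+1.-tuple T => thead t) @^-1` F k `&` (fun t : n.+1.-tuple T => [tuple of behead t]) @^-1` G k.
exists H.
  rewrite predeqE => t; split=> // _.
  have : setT (thead t) by [].
  have : setT [tuple of behead t] by [].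
  rewrite TF TG => -[k _ Gk] [j _ Fj].
  exists (maxn j k) => //; split.
    by have /subsetPset := ndF _ _ (leq_maxl j k); exact.
  by have /subsetPset := ndG _ _ (leq_maxr j k); exact.
move=> k; split.
  apply: measurableI; rewrite -[X in measurable X]setTI.
    by apply: (measurable_tnth (ord0 : 'I_n.+1)) => //; exact: (Foo k).1.
  by apply: (measurable_behead) => //; exact: (Goo k).1.
rewrite /= /tuple_product /pushforward.
have -> : tcons @^-1` H k = F k `*` G k.
  rewrite predeqE => -[x t]; rewrite /H /tcons /=.
  have -> : [tuple of behead [tuple of x :: t]] = t by exact: val_inj.
  by rewrite theadE.
rewrite product_measure1E; [|exact: (Foo k).1|exact: (Goo k).1].
by rewrite lte_mul_pinfty// ?ge0_fin_numE//; [exact: (Foo k).2|exact: (Goo k).2].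
Qed.

HB.instance Definition _ := Measure_isSigmaFinite.Build _ _ _ tuple_product
  tuple_product_sigma_finite.

End tuple_product.

Section lebesgue.
Variable R : realType.

(* d-dimensional Lebesgue measure, as the d-fold product of the
   one-dimensional one, on the product sigma-algebra of R^d. *)
Fixpoint lebesgue (d : nat) :
    {sigma_finite_measure set (d.-tuple (measurableTypeR R)) -> \bar R} :=
  match d with
  | 0 => \d_([tuple] : 0.-tuple (measurableTypeR R))
  | d'.+1 => tuple_product (@lebesgue_measure R) (lebesgue d')
  end.

Definition colt d (t : d.-tuple R) : 'cV[R]_d := \col_i tnth t i.

Definition integral_Rd d (g : 'cV[R]_d -> \bar R) : \bar R :=
  (\int[lebesgue d]_t g (colt t))%E.

End lebesgue.

Section logconcave.
Variables (R : realType) (d : nat).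

(* +oo is an allowed value of psi, -oo is not; 0 * +oo = 0 in \bar R, so the
   cases t = 0 and t = 1 of the inequality are harmless. *)
Definition econvex (psi : 'cV[R]_d -> \bar R) :=
  (forall x, psi x != -oo%E) /\
  (forall (x y : 'cV[R]_d) (t : R), 0 <= t <= 1 ->
    (psi (t *: x + (1 - t) *: y)%R <= t%:E * psi x + (1 - t)%:E * psi y)%E).

Definition log_concave (f : 'cV[R]_d -> R) :=
  exists2 psi : 'cV[R]_d -> \bar R,
    econvex psi & forall x, (f x)%:E = expeR (- psi x)%E.

Definition upper_semicontinuous (f : 'cV[R]_d -> R) :=
  lower_semicontinuous (fun x => (- f x)%:E).

Definition proper_log_concave (f : 'cV[R]_d -> R) :=
  [/\ log_concave f, upper_semicontinuous f &
      (0 < integral_Rd (fun x => (f x)%:E) < +oo)%E].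

End logconcave.

(* R^(d+1) is 'cV_(d + 1): a point (x, xi) is col_mx x xi, the hyperplane R^d
   consists of the points with last coordinate 0. *)
Section ellipsoids.
Variables (R : realType) (d : nat).
Implicit Types (s : R) (f : 'cV[R]_d -> R) (C E : set 'cV[R]_(d + 1)).

(* The norm of 'cV[R]_n in the library is the sup norm, hence the formula. *)
Definition euclidean_ball n : set 'cV[R]_n :=
  [set u | \sum_(i < n) u i 0 ^+ 2 <= 1].

Definition positive_definite n (A : 'M[R]_n) :=
  A^T = A /\ forall x : 'cV[R]_n, x != 0 -> 0 < (x^T *m A *m x) 0 0.

Definition dsym_ellipsoid_of (A : 'M[R]_d) (alpha : R) (a : 'cV[R]_d) :
    set 'cV[R]_(d + 1) :=
  [set block_mx A 0 0 alpha%:M *m u + col_mx a 0 | u in @euclidean_ball (d + 1)].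

Definition dsym_ellipsoid E :=
  exists A alpha a,
    [/\ positive_definite A, 0 < alpha & E = dsym_ellipsoid_of A alpha a].

Definition lifting s f : set 'cV[R]_(d + 1) :=
  [set z | `|dsubmx z 0 0| <= f (usubmx z) `^ s^-1].

Definition fiber C (x : 'cV[R]_d) : set R := [set xi | C (col_mx x xi%:M)].

Definition svolume s C : \bar R :=
  integral_Rd (fun x => ((2^-1)%:E * lebesgue_measure (fiber C x)) `^ s)%E.

Definition John_ellipsoid s f E :=
  [/\ dsym_ellipsoid E, E `<=` lifting s f &
      forall E', dsym_ellipsoid E' -> E' `<=` lifting s f ->
        (svolume s E' <= svolume s E)%E].

End ellipsoids.

(* Main.v *)
Require Import Defs.
From mathcomp Require Import all_boot all_order all_algebra.
From mathcomp Require Import all_classical all_reals all_analysis.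
From mathcomp Require Import measurable_realfun ring lra.
Set Implicit Arguments.
Unset Strict Implicit.
Unset Printing Implicit Defensive.
Import Order.TTheory GRing.Theory Num.Theory.
Import numFieldNormedType.Exports.
Local Open Scope classical_set_scope.
Local Open Scope ring_scope.

(* With phi v = (1 - |v|^2)_+^(s/2), the ellipsoid (A (+) alpha) B + a lies in
   the s-lifting of f iff p * phi v <= f (A v + a) for all v, where
   p = alpha^s, and its s-volume is p * det A * kappa with kappa the integral
   of phi.  Log-concavity of f makes the admissible triples (A, p, a) stable
   under (arithmetic, geometric, arithmetic) means.  Comparing an arbitrary
   ellipsoid with a fixed ball in this way, and using that the s-volume never
   exceeds the integral of f, bounds all triples of non-negligible volume, so
   that a maximum exists by compactness.  For two maximal triples, the strict
   log-concavity of det forces the shapes, hence the heights, to be equal; if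
   the centers differed by 2 b, then all the translates along the segment
   between them would be admissible, and so would be the larger shape
   A + b b^T / |b|. *)

(** No spectral theory is used. Eliminating one coordinate replaces a form by its Schur complement,
    and induction on the dimension then yields the positivity and monotonicity of [\det], its strict
    log-concavity and the change of variables for the integral.

    Three degenerations have to be excluded. Possibly no ellipsoid fits at all: this would need f to
    live on a hyperplane, which the positivity of its integral forbids. Possibly kappa is infinite:
    it is never computed, and its finiteness follows from one contained ball and the finite integral
    of f. Possibly a maximizing sequence escapes: the mean with a ball of shape r and height p0 has
    squared volume p0 p det((A + r)/2)^2 up to kappa^2, where the shape counts twice and the height
    once. At volume bounded below, a height tending to 0 makes this blow up; once the height is
    bounded below, so does a large diagonal entry.

    Positive definiteness is not a closed condition, so compactness is applied to semidefinite
    shapes of height at least some q > 0, and the positive volume of the maximum restores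
    definiteness. *)

Section quadratic_forms.
Variable R : realType.
Implicit Types n : nat.

Definition quad n (A : 'M[R]_n) (x : 'cV[R]_n) : R := (x^T *m A *m x) 0 0.
Definition dotv n (x y : 'cV[R]_n) : R := (x^T *m y) 0 0.
Definition normsq n (x : 'cV[R]_n) : R := \sum_(i < n) x i 0 ^+ 2.

Lemma quadE n (A : 'M[R]_n) x :
  quad A x = \sum_i \sum_j x i 0 * A i j * x j 0.
Proof.
rewrite /quad -mulmxA mxE; apply: eq_bigr => i _; rewrite !mxE mulr_sumr.
by apply: eq_bigr => j _; rewrite mulrA.
Qed.

Lemma dotvE n (x y : 'cV[R]_n) : dotv x y = \sum_i x i 0 * y i 0.
Proof. by rewrite /dotv mxE; apply: eq_bigr => i _; rewrite mxE. Qed.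

Lemma dotvx n (x : 'cV[R]_n) : dotv x x = normsq x.
Proof. by rewrite dotvE; apply: eq_bigr => i _; rewrite expr2. Qed.

Lemma normsq_ge0 n (x : 'cV[R]_n) : 0 <= normsq x.
Proof. by apply: sumr_ge0 => i _; rewrite sqr_ge0. Qed.

Lemma normsq_eq0 n (x : 'cV[R]_n) : (normsq x == 0) = (x == 0).
Proof.
apply/idP/eqP => [|->]; last first.
  by rewrite /normsq big1// => i _; rewrite mxE expr0n.
rewrite psumr_eq0 => [|i _]; last exact: sqr_ge0.
move/allP => h; apply/colP => i; rewrite mxE.
by have := h i (mem_index_enum _); rewrite sqrf_eq0 => /eqP.
Qed.

Lemma normsq_gt0 n (x : 'cV[R]_n) : (0 < normsq x) = (x != 0).
Proof. by rewrite lt_neqAle normsq_ge0 andbT eq_sym normsq_eq0. Qed.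

Lemma quadD n (A B : 'M[R]_n) x : quad (A + B) x = quad A x + quad B x.
Proof. by rewrite /quad mulmxDr mulmxDl mxE. Qed.

Lemma quadZ n c (A : 'M[R]_n) x : quad (c *: A) x = c * quad A x.
Proof. by rewrite /quad -scalemxAr -scalemxAl mxE. Qed.

Lemma quad_scalar n c (x : 'cV[R]_n) : quad c%:M x = c * normsq x.
Proof. by rewrite -scalemx1 quadZ -dotvx /quad /dotv mulmx1. Qed.

Lemma quad_outer n (b x : 'cV[R]_n) : quad (b *m b^T) x = dotv b x ^+ 2.
Proof.
rewrite /quad /dotv mulmxA -mulmxA mxE big_ord1 expr2; congr (_ * _).
by rewrite -[x^T *m b]trmxK trmx_mul trmxK mxE.
Qed.

Lemma quad0 n (A : 'M[R]_n) : quad A 0 = 0.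
Proof. by rewrite /quad mulmx0 mxE. Qed.

(** * Elimination of the first coordinate: Schur complements *)

Lemma quad_block n a (b : 'cV[R]_n) C y x :
  quad (block_mx a%:M b^T b C : 'M[R]_(1 + n)) (col_mx y%:M x) =
  a * y ^+ 2 + 2 * y * dotv b x + quad C x.
Proof.
have mxD (M N : 'M[R]_1) : (M + N) 0 0 = M 0 0 + N 0 0 by rewrite mxE.
rewrite /quad tr_col_mx mul_row_block mul_row_col tr_scalar_mx !mulmxDl !mxD.
have -> : ((y%:M *m b^T *m x) 0 0 : R) = y * dotv b x.
  by rewrite mul_scalar_mx -scalemxAl mxE.
have -> : ((x^T *m b *m y%:M) 0 0 : R) = y * dotv b x.
  by rewrite mul_mx_scalar mxE -[x^T *m b]trmxK trmx_mul trmxK mxE.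
rewrite -!scalar_mxM mxE eqxx mulr1n; ring.
Qed.

Definition schur n (a : R) (b : 'cV[R]_n) (C : 'M[R]_n) : 'M[R]_n :=
  C - a^-1 *: (b *m b^T).

Lemma quad_block_schur n a (b : 'cV[R]_n) C y x : a != 0 ->
  quad (block_mx a%:M b^T b C : 'M[R]_(1 + n)) (col_mx y%:M x) =
  a * (y + a^-1 * dotv b x) ^+ 2 + quad (schur a b C) x.
Proof.
move=> a0; rewrite quad_block /schur -scaleNr quadD quadZ quad_outer.
by field.
Qed.

Lemma det_block_schur n a (b : 'cV[R]_n) C : a != 0 ->
  \det (block_mx a%:M b^T b C : 'M[R]_(1 + n)) = a * \det (schur a b C).
Proof.
move=> a0.
have -> : block_mx a%:M b^T b C =
    block_mx 1%:M 0 (a^-1 *: b) 1%:M *m block_mx a%:M b^T 0 (schur a b C).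
  rewrite mulmx_block !mul1mx !mul0mx !addr0 mul_mx_scalar.
  rewrite scalerA divff// scale1r /schur -scalemxAl; congr block_mx.
  by rewrite addrC subrK.
by rewrite det_mulmx det_lblock det_ublock !det1 !mul1r det_scalar1.
Qed.

Lemma scalar_mx11 (M : 'M[R]_1) : M = (M 0 0)%:M.
Proof. by rewrite -mx11_scalar. Qed.

Lemma sym_blockP n (A : 'M[R]_(1 + n)) : A^T = A ->
  exists a b C, A = block_mx a%:M b^T b C /\ C^T = C.
Proof.
move=> sA; exists (ulsubmx A 0 0), (dlsubmx A), (drsubmx A); split.
  rewrite -scalar_mx11 -{1}[A]submxK; congr block_mx.
  by rewrite trmx_dlsub sA.
by rewrite trmx_drsub sA.
Qed.

Lemma schur_sym n a (b : 'cV[R]_n) C : C^T = C -> (schur a b C)^T = schur a b C.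
Proof. by move=> sC; rewrite /schur !linearD !linearN !linearZ/= sC trmx_mul trmxK. Qed.

Lemma col_mx_scalarP n (x : 'cV[R]_(1 + n)) : exists y x', x = col_mx y%:M x'.
Proof.
by exists (usubmx x 0 0), (dsubmx x); rewrite -scalar_mx11 vsubmxK.
Qed.

(** Evaluating at [(1, 0)] gives [0 < a]. Evaluating at the vector whose first coordinate cancels
    the square in [quad_block_schur] leaves the form of the Schur complement alone. *)
Lemma pd_blockP n (A : 'M[R]_(1 + n)) : positive_definite A ->
  exists a b C, [/\ A = block_mx a%:M b^T b C, 0 < a, C^T = C &
    positive_definite (schur a b C)].
Proof.
move=> [sA pA]; have [a [b [C [AE sC]]]] := sym_blockP sA.
have qA x : x != 0 -> 0 < quad A x by exact: pA.
have a0 : 0 < a.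
  have : 0 < quad A (col_mx 1%:M 0).
    apply: qA; apply/eqP => /(congr1 (fun M => usubmx M 0 0)).
    rewrite col_mxKu !mxE eqxx /=; apply/eqP; exact: oner_neq0.
  by rewrite AE quad_block quad0 dotvE big1 ?expr1n => [|i _]; rewrite ?mxE; lra.
exists a, b, C; split=> //; split; first exact: schur_sym.
move=> x x0; have := qA (col_mx (- (a^-1 * dotv b x))%:M x).
rewrite AE quad_block_schur ?gt_eqF// addNr expr0n mulr0 add0r; apply.
apply/eqP => /(congr1 dsubmx); rewrite col_mxKd => xE.
by move/eqP: x0; apply; rewrite xE; apply/colP => i; rewrite !mxE.
Qed.

Lemma pd_det_gt0 n (A : 'M[R]_n) : positive_definite A -> 0 < \det A.
Proof.
elim: n A => [A _|n ih A pA]; first by rewrite det_mx00.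
have [a [b [C [-> a0 _ pS]]]] := pd_blockP pA.
by rewrite det_block_schur ?gt_eqF// mulr_gt0// ih.
Qed.

Lemma pd_unitmx n (A : 'M[R]_n) : positive_definite A -> A \in unitmx.
Proof. by move=> /pd_det_gt0 dA; rewrite unitmxE unitfE gt_eqF. Qed.

Lemma quad_pd n (A : 'M[R]_n) x : positive_definite A -> 0 <= quad A x.
Proof.
by move=> [_ pA]; have [->|/pA/ltW//] := eqVneq x 0; rewrite quad0.
Qed.

(** * Monotonicity and strict log-concavity of the determinant *)

Lemma pd_le n (A B : 'M[R]_n) : positive_definite A -> B^T = B ->
  (forall x, quad A x <= quad B x) -> positive_definite B.
Proof.
move=> [_ pA] sB AB; split=> // x x0.
exact: lt_le_trans (pA x x0) (AB x).
Qed.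

Lemma dotvBl n (b b' x : 'cV[R]_n) : dotv (b - b') x = dotv b x - dotv b' x.
Proof. by rewrite !dotvE -sumrB; apply: eq_bigr => i _; rewrite !mxE mulrBl. Qed.

Lemma dotv_eq n (b b' : 'cV[R]_n) : (forall x, dotv b x = dotv b' x) -> b = b'.
Proof.
move=> h; by apply/eqP; rewrite -subr_eq0 -normsq_eq0 -dotvx dotvBl h subrr.
Qed.

Lemma quad_e0 n a (b : 'cV[R]_n) C :
  quad (block_mx a%:M b^T b C : 'M[R]_(1 + n)) (col_mx 1%:M 0) = a.
Proof. by rewrite quad_block quad0 dotvE big1 ?expr1n => [|i _]; rewrite ?mxE; lra. Qed.

Lemma mul_le_eq (x x' p p' : R) : 0 < x -> x <= x' -> 0 < p -> p <= p' ->
  x * p = x' * p' -> x = x' /\ p = p'.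
Proof. by move=> x0 xx' p0 pp' e; split; nra. Qed.

(** The Schur form at [x] is the minimum over [y] of the full form at [(y, x)]. Hence the order
    passes to the Schur complements, and the determinants compare factor by factor. *)
Lemma det_le n (A B : 'M[R]_n) : positive_definite A -> B^T = B ->
  (forall x, quad A x <= quad B x) ->
  \det A <= \det B /\ (\det A = \det B -> A = B).
Proof.
elim: n A B => [A B _ _ _|n ih A B pA sB AB].
  by rewrite !det_mx00; split=> // _; apply/matrixP => -[].
have pB := pd_le pA sB AB.
have [a [b [C [AE a0 sC pS]]]] := pd_blockP pA.
have [a' [b' [C' [BE a'0 sC' pS']]]] := pd_blockP pB.
have le_aa' : a <= a'.
  by have := AB (col_mx (1%:M : 'M[R]_1) (0 : 'cV[R]_n)); rewrite AE BE !quad_e0.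
have q y x : a * (y + a^-1 * dotv b x) ^+ 2 + quad (schur a b C) x <=
             a' * (y + a'^-1 * dotv b' x) ^+ 2 + quad (schur a' b' C') x.
  by rewrite -!quad_block_schur ?gt_eqF// -AE -BE.
have le_S x : quad (schur a b C) x <= quad (schur a' b' C') x.
  have := q (- (a'^-1 * dotv b' x)) x; rewrite addNr expr0n mulr0 add0r.
  by apply: le_trans; rewrite lerDr mulr_ge0 ?sqr_ge0 ?ltW.
have [dS eS] := ih _ _ pS (schur_sym _ _ sC') le_S.
rewrite AE BE !det_block_schur ?gt_eqF//; split.
  by apply: ler_pM => //; rewrite ltW// pd_det_gt0.
have dS0 := pd_det_gt0 pS.
move=> /(mul_le_eq a0 le_aa' dS0 dS)[aa' /eS SS'].
(* The first coordinate is chosen to cancel the square on the right; the square on the left is then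
   nonpositive, hence zero. *)
have bb' : b = b'.
  apply: dotv_eq => x; have := q (- (a^-1 * dotv b' x)) x.
  rewrite SS' -aa' lerD2r addNr expr0n mulr0 => le0.
  have : (- (a^-1 * dotv b' x) + a^-1 * dotv b x) ^+ 2 <= 0.
    by rewrite -(pmulr_rle0 _ a0).
  rewrite real_exprn_even_le0 ?num_real//= addrC subr_eq0 => /eqP.
  by apply: mulfI; rewrite invr_eq0 gt_eqF.
by move: SS'; rewrite -aa' -bb' => /addIr ->.
Qed.

Lemma quad_mid n (A B : 'M[R]_n) x :
  quad (2^-1 *: (A + B)) x = (quad A x + quad B x) / 2.
Proof. by rewrite quadZ quadD mulrC. Qed.

Lemma pd_mid n (A B : 'M[R]_n) : positive_definite A -> positive_definite B ->
  positive_definite (2^-1 *: (A + B)).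
Proof.
move=> [sA pA] [sB pB]; split; first by rewrite linearZ linearD/= sA sB.
move=> x x0; rewrite -/(quad _ x) quad_mid divr_gt0// addr_gt0//; by [exact: pA|exact: pB].
Qed.

Lemma mid_sym n (A B : 'M[R]_n) : A^T = A -> B^T = B ->
  (2^-1 *: (A + B))^T = 2^-1 *: (A + B).
Proof. by move=> sA sB; rewrite linearZ linearD/= sA sB. Qed.

(** The minimum of a sum is at least the sum of the minima, so the Schur complement of the mean
    dominates the mean of the Schur complements. Combine this, through [det_le], with the induction
    hypothesis and a a' <= ((a + a') / 2)^2; equality of the products forces equality in all three
    estimates. *)
Lemma det_mid n (A B : 'M[R]_n) : positive_definite A -> positive_definite B ->
  \det A * \det B <= \det (2^-1 *: (A + B)) ^+ 2 /\
  (\det A * \det B = \det (2^-1 *: (A + B)) ^+ 2 -> A = B).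
Proof.
elim: n A B => [A B _ _|n ih A B pA pB].
  by rewrite !det_mx00 mulr1 expr1n; split=> // _; apply/matrixP => -[].
have [a [b [C [AE a0 sC pS]]]] := pd_blockP pA.
have [a' [b' [C' [BE a'0 sC' pS']]]] := pd_blockP pB.
set S := schur a b C in pS; set S' := schur a' b' C' in pS'.
pose m := 2^-1 * (a + a'); pose bm := 2^-1 *: (b + b').
pose Cm := 2^-1 *: (C + C').
have m0 : 0 < m by rewrite /m mulr_gt0// addr_gt0.
have ME : 2^-1 *: (A + B) = block_mx m%:M bm^T bm Cm.
  rewrite AE BE (@add_block_mx R 1 n 1 n) (@scale_block_mx R 1 n 1 n) /m /bm /Cm.
  by rewrite -raddfD/= scale_scalar_mx [in RHS]linearZ [in RHS]linearD.
have q y x : m * (y + m^-1 * dotv bm x) ^+ 2 + quad (schur m bm Cm) x =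
   (a * (y + a^-1 * dotv b x) ^+ 2 + quad S x +
    (a' * (y + a'^-1 * dotv b' x) ^+ 2 + quad S' x)) / 2.
  by rewrite -!quad_block_schur ?gt_eqF// -ME -AE -BE quad_mid.
have le_S x : quad (2^-1 *: (S + S')) x <= quad (schur m bm Cm) x.
  have := q (- (m^-1 * dotv bm x)) x; rewrite addNr expr0n mulr0 add0r => ->.
  rewrite quad_mid ler_pM2r// lerD// lerDr mulr_ge0 ?sqr_ge0//; exact: ltW.
have sCm : Cm^T = Cm by exact: mid_sym.
have pN := pd_mid pS pS'.
have [dM eM] := det_le pN (schur_sym m bm sCm) le_S.
have [dN eN] := ih _ _ pS pS'.
have aam : a * a' <= m ^+ 2 by rewrite /m; have := sqr_ge0 (a - a'); nra.
have N0 := pd_det_gt0 pN.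
have dM2 : \det (2^-1 *: (S + S')) ^+ 2 <= \det (schur m bm Cm) ^+ 2.
  by rewrite ler_pXn2r// nnegrE ltW// (lt_le_trans N0).
have dSS0 : 0 < \det S * \det S' by rewrite mulr_gt0// pd_det_gt0.
rewrite ME AE BE !det_block_schur ?gt_eqF// -/S -/S' exprMn mulrACA.
split.
  by apply: ler_pM; rewrite ?(ltW dSS0)//; [rewrite mulr_ge0 ?ltW|exact: le_trans dM2].
have aa0 : 0 < a * a' by rewrite mulr_gt0.
move=> /(mul_le_eq aa0 aam dSS0 (le_trans dN dM2))[aaE dE].
have aa' : a = a'.
  move: aaE; rewrite /m => aaE; apply/eqP; rewrite -subr_eq0 -sqrf_eq0.
  by apply/eqP; nra.
have SS' : S = S'.
  by apply: eN; apply: le_anti; rewrite dN dE dM2.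
have NM : 2^-1 *: (S + S') = schur m bm Cm.
  apply: eM; apply/eqP; rewrite eq_le dM/= -(ler_pXn2r (n := 2))// ?nnegrE.
  - by rewrite -dE.
  - by rewrite ltW// (lt_le_trans N0).
  - exact: ltW.
have mE : m = a by rewrite /m -aa'; lra.
(* Cancelling the square of the second form leaves [a * (E / 2) ^+ 2 = a * E ^+ 2 / 2], hence
   [E = 0]. *)
have bb' : b = b'.
  apply: dotv_eq => x; have := q (- (a^-1 * dotv b' x)) x.
  rewrite -NM quad_mid -SS' mE -aa' addNr expr0n mulr0 add0r.
  set D := - _ + _; set E := - _ + _.
  have -> : D = E / 2.
    rewrite /D /E /bm.
    have -> : dotv (2^-1 *: (b + b')) x = 2^-1 * (dotv b x + dotv b' x).
      by rewrite /dotv linearZ linearD/= -scalemxAl mxE mulmxDl mxE.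
    by field; rewrite gt_eqF.
  move=> h; have : a * E ^+ 2 = 0 by lra.
  move/eqP; rewrite mulf_eq0 gt_eqF//= sqrf_eq0 /E addrC subr_eq0 => /eqP.
  by apply: mulfI; rewrite invr_eq0 gt_eqF.
by move: SS'; rewrite /S /S' -aa' -bb' => /addIr ->.
Qed.

(* Both sides are the determinant of [[1, -v^T], [u, 1]], eliminated from
   either corner. *)
Lemma det_add1_outer n (u v : 'cV[R]_n) : \det (1%:M + u *m v^T) = 1 + dotv v u.
Proof.
pose P : 'M[R]_(1 + n) := block_mx 1%:M (- v^T) u 1%:M.
transitivity (\det P).
  have -> : P = block_mx 1%:M 0 u 1%:M *m block_mx 1%:M (- v^T) 0 (1%:M + u *m v^T).
    rewrite mulmx_block ?(mul1mx, mul0mx, mulmx0, mulmx1) ?addr0 mulmxN /P.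
    by rewrite addrCA addNr addr0.
  by rewrite det_mulmx det_lblock det_ublock !det1 !mul1r.
have -> : P = block_mx (1%:M + v^T *m u) (- v^T) 0 1%:M *m block_mx 1%:M 0 u 1%:M.
  rewrite mulmx_block ?(mul1mx, mul0mx, mulmx0, mulmx1) ?add0r mulNmx /P.
  by rewrite addrK.
by rewrite det_mulmx det_lblock det_ublock !det1 !mulr1 det_mx11 !mxE /dotv mxE.
Qed.

Lemma det_scalar_outer n (r t : R) (b : 'cV[R]_n) : r != 0 ->
  \det (r%:M + t *: (b *m b^T)) = r ^+ n * (1 + t / r * normsq b).
Proof.
move=> r0.
have -> : r%:M + t *: (b *m b^T) = r *: (1%:M + ((t / r) *: b) *m b^T).
  rewrite scalerDr scalemx1 -scalemxAl scalerA; congr (_ + _ *: _).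
  by rewrite mulrCA divff// mulr1.
by rewrite detZ det_add1_outer /dotv -scalemxAr mxE -dotvx.
Qed.

Lemma pd_add_outer n (A : 'M[R]_n) (t : R) (b : 'cV[R]_n) : positive_definite A -> 0 <= t ->
  positive_definite (A + t *: (b *m b^T)).
Proof.
move=> pA t0; apply: (pd_le pA) => [|x].
  by case: pA => sA _; rewrite linearD linearZ/= trmx_mul trmxK sA.
by rewrite quadD quadZ quad_outer lerDl mulr_ge0// sqr_ge0.
Qed.

(** Equal determinants would force equal matrices by [det_le], but the two forms differ at [b] by
    [t * normsq b ^+ 2]. *)
Lemma det_add_outer n (A : 'M[R]_n) (t : R) (b : 'cV[R]_n) :
  positive_definite A -> 0 < t -> b != 0 ->
  \det A < \det (A + t *: (b *m b^T)).
Proof.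
move=> pA t0 b0; have [sA' _] := pd_add_outer b pA (ltW t0).
have le x : quad A x <= quad (A + t *: (b *m b^T)) x.
  by rewrite quadD quadZ quad_outer lerDl mulr_ge0 ?sqr_ge0// ltW.
have [d e] := det_le pA sA' le; rewrite lt_neqAle d andbT.
apply/eqP => /e /(congr1 (fun M => quad M b)).
rewrite quadD quadZ quad_outer dotvx => /eqP.
rewrite -subr_eq0 opprD addrA subrr add0r oppr_eq0 mulf_eq0 gt_eqF//= sqrf_eq0.
by rewrite normsq_eq0 (negbTE b0).
Qed.

Lemma pd_scalar n (r : R) : 0 < r -> positive_definite (r%:M : 'M[R]_n).
Proof.
move=> r0; split; first exact: tr_scalar_mx.
by move=> x x0; rewrite -/(quad _ x) quad_scalar mulr_gt0// normsq_gt0.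
Qed.

End quadratic_forms.

Section affine_substitution.
Variable R : realType.
Local Notation mu := (@lebesgue_measure R).

Definition affine (a c : R) (x : measurableTypeR R) : measurableTypeR R := a * x + c.

Lemma measurable_affine (a c : R) : measurable_fun setT (affine a c).
Proof. by apply: measurable_funD => //; apply: measurable_funM. Qed.

(** The right-hand side is a measure in [A] that agrees with length on half-open intervals, so the
    uniqueness of Lebesgue measure applies. *)
Lemma lebesgue_measure_affine (a c : R) (a0 : 0 < a) (A : set (measurableTypeR R)) :
  measurable A -> mu A = (a%:E * mu (affine a c @^-1` A))%E.
Proof.
move=> mA; pose r : {nonneg R} := NngNum (ltW a0).
pose nu : {measure set (measurableTypeR R) -> \bar R} :=
  mscale r (pushforward mu (affine a c)).
apply: (@lebesgue_measure_unique R (nu (measurable_affine a c))) => //.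
move=> _ [[x y]] _ <-.
pose u := (x - c) / a; pose v := (y - c) / a.
transitivity (a%:E * mu (`]u, v]%classic : set R))%E; last first.
  congr (_ * mu _)%E; apply/seteqP; split=> z /=; rewrite !in_itv/= /affine /u /v;
    by rewrite ltr_pdivrMr// ler_pdivlMr// ltrBlDr lerBrDr [z * a]mulrC.
rewrite !lebesgue_measure_itv/= !lte_fin /u /v ltr_pM2r ?invr_gt0// ltrD2r.
case: ifPn => xy; last by rewrite mule0.
rewrite -!EFinD -EFinM; congr EFin.
by field; rewrite gt_eqF.
Qed.

Lemma ge0_integral_affine (a c : R) (h : R -> \bar R) : 0 < a ->
  measurable_fun [set: R] h -> (forall x, (0 <= h x)%E) ->
  (\int[mu]_x h x = a%:E * \int[mu]_x h (affine a c x))%E.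
Proof.
move=> a0 mh h0; pose r : {nonneg R} := NngNum (ltW a0).
pose nu : {measure set (measurableTypeR R) -> \bar R} :=
  mscale r (pushforward mu (affine a c)).
rewrite (eq_measure_integral (nu (measurable_affine a c))); last first.
  by move=> A mA _; rewrite /mscale/= (lebesgue_measure_affine c a0 mA).
rewrite ge0_integral_mscale//; congr (_ * _)%E.
by rewrite ge0_integral_pushforward//; exact: measurable_affine.
Qed.

End affine_substitution.

(** * Iterated integrals and the affine change of variables *)

Section integral_on_Rd.
Variable R : realType.
Local Notation T := (measurableTypeR R).
Local Notation mu := (@lebesgue_measure R).
Local Open Scope ereal_scope.

Definition measurable_Rd d (g : 'cV[R]_d -> \bar R) :=
  measurable_fun [set: d.-tuple T] (fun t : d.-tuple T => g (colt t)).

Lemma colt_tcons d (x : T) (t : d.-tuple T) :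
  colt (tcons (x, t)) = col_mx (x%:M)%R (colt t) :> 'cV[R]_(1 + d).
Proof.
apply/colP => i; rewrite mxE; case: (split_ordP i) => j ->.
  by rewrite col_mxEu mxE ord1 eqxx mulr1n /tcons (tnth_nth 0%R).
by rewrite col_mxEd mxE /tcons !(tnth_nth 0%R).
Qed.

Section cons.
Variables (d : nat) (g : 'cV[R]_(1 + d) -> \bar R).
Hypothesis mg : measurable_Rd (g : 'cV[R]_d.+1 -> \bar R).
Hypothesis g0 : forall x, 0 <= g x.

Let G (p : T * d.-tuple T) := g (colt (tcons p)).

Let mG : measurable_fun [set: T * d.-tuple T] G.
Proof. exact: (measurableT_comp mg (@measurable_tcons _ _ _)). Qed.

Let GE x t : G (x, t) = g (col_mx (x%:M)%R (colt t)).
Proof. by rewrite /G colt_tcons. Qed.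

Let integral_G :
  integral_Rd (g : 'cV[R]_d.+1 -> \bar R) = \int[mu \x lebesgue R d]_p G p.
Proof.
rewrite /integral_Rd/= /tuple_product ge0_integral_pushforward//.
exact: measurable_tcons.
Qed.

Lemma integral_Rd_cons1 : integral_Rd (g : 'cV[R]_d.+1 -> \bar R) =
  \int[mu]_x integral_Rd (fun t => g (col_mx (x%:M)%R t)).
Proof.
rewrite integral_G (fubini_tonelli1 G mG (fun=> g0 _)).
by apply: eq_integral => x _; apply: eq_integral => t _; rewrite GE.
Qed.

Lemma integral_Rd_cons2 : integral_Rd (g : 'cV[R]_d.+1 -> \bar R) =
  \int[lebesgue R d]_t \int[mu]_x g (col_mx (x%:M)%R (colt t)).
Proof.
rewrite integral_G (fubini_tonelli2 G mG (fun=> g0 _)).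
by apply: eq_integral => x _; apply: eq_integral => t _; rewrite GE.
Qed.

Lemma measurable_integral_slice1 :
  measurable_fun [set: T] (fun x : T => integral_Rd (fun t => g (col_mx (x%:M)%R t))).
Proof.
have := measurable_fun_fubini_tonelli_F (m2 := lebesgue R d) G mG (fun=> g0 _).
congr measurable_fun; apply/funext => x.
by apply: eq_integral => t _; rewrite GE.
Qed.

Lemma measurable_integral_slice2 : measurable_fun [set: d.-tuple T]
  (fun t : d.-tuple T => \int[mu]_x g (col_mx (x%:M)%R (colt t))).
Proof.
have := measurable_fun_fubini_tonelli_G (m1 := mu) G mG (fun=> g0 _).
congr measurable_fun; apply/funext => t.
by apply: eq_integral => x _; rewrite GE.
Qed.

Lemma measurable_Rd_slice1 (x : R) : measurable_Rd (fun t => g (col_mx (x%:M)%R t)).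
Proof.
have := measurable_fun_pair2 x mG.
by congr measurable_fun; apply/funext => t; rewrite GE.
Qed.

Lemma measurable_Rd_slice2 (t : d.-tuple T) :
  measurable_fun [set: T] (fun x : T => g (col_mx (x%:M)%R (colt t))).
Proof.
have := measurable_fun_pair1 t mG.
by congr measurable_fun; apply/funext => x; rewrite GE.
Qed.

End cons.

Lemma measurable_Rd_affine m d (A : 'M[R]_(m, d)) (c : 'cV[R]_m) g :
  measurable_Rd g -> measurable_Rd (fun x => g (A *m x + c)%R).
Proof.
move=> mg.
pose phi (t : d.-tuple T) : m.-tuple T := [tuple (A *m colt t + c)%R i ord0 | i < m].
have phiE t : colt (phi t) = (A *m colt t + c)%R.
  by apply/colP => i; rewrite mxE tnth_mktuple.
have mphi : measurable_fun [set: d.-tuple T] phi.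
  apply/measurable_fun_tnthP => i.
  rewrite (_ : _ \o _ = fun t : d.-tuple T => (\sum_j A i j * tnth t j + c i ord0)%R).
    apply: measurable_funD => //; apply: measurable_sum => j.
    by apply: measurable_funM => //; exact: measurable_tnth.
  apply/funext => t; rewrite /= tnth_mktuple !mxE; congr (_ + _)%R.
  by apply: eq_bigr => j _; rewrite mxE.
have := measurableT_comp mg mphi.
by congr measurable_fun; apply/funext => t /=; rewrite phiE.
Qed.

Lemma integral_Rd0 (g : 'cV[R]_0 -> \bar R) : integral_Rd g = g 0%R.
Proof.
have e (x : 'cV[R]_0) : g x = g 0%R by congr g; apply/colP => -[].
rewrite /integral_Rd/= integral_dirac//.
  by rewrite diracT mul1e e.
rewrite (_ : (fun _ => _) = cst (g 0%R)); first exact: measurable_cst.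
by apply/funext => t /=; rewrite e.
Qed.

(* Eliminating the first coordinate turns [A] into its Schur complement. *)
Lemma integral_Rd_affine d (A : 'M[R]_d) (c : 'cV[R]_d) g :
  positive_definite A -> measurable_Rd g -> (forall x, 0 <= g x) ->
  integral_Rd g = (\det A)%:E * integral_Rd (fun x => g (A *m x + c)%R).
Proof.
elim: d A c g => [A c g _ _ _|d ih A c g pA mg g0].
  rewrite det_mx00 mul1e !integral_Rd0; congr g; by apply/colP => -[].
have [a [b [C [AE a0 _ pS]]]] := pd_blockP pA.
have [c0 [c' cE]] := col_mx_scalarP (c : 'cV[R]_(1 + d)).
pose S := schur a b C; rewrite -/S in pS.
(* The affine map is split in two. At fixed x, the first coordinate y becomes u = a y + b.x + c0,
   which accounts for the factor a; at fixed u, the other coordinates undergo an affine map with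
   linear part [S], left to the induction. [L] and [k] describe this second map, and each half uses
   its own order of integration. *)
pose L : 'M[R]_(1 + d) := block_mx 1%:M 0 (a^-1 *: b) S.
pose k : 'cV[R]_(1 + d) := col_mx 0 (c' - (a^-1 * c0) *: b).
pose g2 (x : 'cV[R]_(1 + d)) := g (L *m x + k)%R.
have mg2 : measurable_Rd (g2 : 'cV[R]_d.+1 -> \bar R).
  exact: (measurable_Rd_affine (L : 'M[R]_d.+1) k mg).
have g20 x : 0 <= g2 x by exact: g0.
have LkE y x : (L *m col_mx y%:M x + k =
    col_mx y%:M (S *m x + (c' + (a^-1 * (y - c0)) *: b)))%R.
  rewrite /L /k mul_block_col add_col_mx mul1mx mul0mx !addr0 mul_mx_scalar scalerA.
  congr col_mx; rewrite [(y * _)%R]mulrC mulrBr scalerBl.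
  by rewrite [(_ *: b + S *m x)%R]addrC -addrA; congr (_ + _)%R; rewrite addrCA.
have AcE y x : ((A : 'M[R]_(1 + d)) *m col_mx y%:M x + c =
    col_mx (a * y + (dotv b x + c0))%:M
     (S *m x + (c' + (a^-1 * (a * y + (dotv b x + c0) - c0)) *: b)))%R.
  rewrite AE cE mul_block_col add_col_mx -scalar_mxM; congr col_mx.
    by rewrite (scalar_mx11 (b^T *m x)) -!raddfD/= addrA.
  have -> : (a^-1 * (a * y + (dotv b x + c0) - c0) = y + a^-1 * dotv b x)%R.
    by field; rewrite gt_eqF.
  have -> : (S *m x = C *m x - (a^-1 * dotv b x) *: b)%R.
    rewrite /S /schur mulmxBl -scalemxAl -mulmxA (scalar_mx11 (b^T *m x)).
    by rewrite mul_mx_scalar scalerA.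
  rewrite scalerDl mul_mx_scalar.
  set p := (y *: b)%R; set q := (_ *: b)%R; set r := (C *m x)%R.
  by move: p q r => p q r; apply/colP => i; rewrite !mxE; ring.
have gAE y x : g ((A : 'M[R]_(1 + d)) *m col_mx y%:M x + c)%R =
    g2 (col_mx (a * y + (dotv b x + c0))%:M x)%R.
  by rewrite /g2 AcE LkE.
have mgA := measurable_Rd_affine A c mg.
have inner (t : d.-tuple T) :
  \int[mu]_x g ((A : 'M[R]_(1 + d)) *m col_mx x%:M (colt t) + c)%R =
    (a^-1)%:E * \int[mu]_y g2 (col_mx y%:M (colt t))%R.
  rewrite (@ge0_integral_affine _ a (dotv b (colt t) + c0)%R
    (fun y => g2 (col_mx y%:M (colt t))%R))//; last exact: measurable_Rd_slice2.
  rewrite muleA -EFinM mulVf ?gt_eqF// mul1e.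
  by apply: eq_integral => x _; rewrite gAE.
have -> : integral_Rd (fun x => g (A *m x + c)%R) =
    (a^-1)%:E * integral_Rd (g2 : 'cV[R]_d.+1 -> \bar R).
  rewrite (integral_Rd_cons2 mgA)// (eq_integral _ _ (fun t _ => inner t)).
  rewrite ge0_integralZl_EFin//; last 3 first.
  - by move=> t _; exact: integral_ge0.
  - exact: measurable_integral_slice2.
  - by rewrite invr_ge0 ltW.
  by rewrite -integral_Rd_cons2.
rewrite AE det_block_schur ?gt_eqF// -/S [(a * _)%R]mulrC EFinM -muleA.
rewrite [X in _ * X]muleA -EFinM divff ?gt_eqF// mul1e.
rewrite (integral_Rd_cons1 mg2)// (integral_Rd_cons1 mg)//.
rewrite -ge0_integralZl_EFin//; last 3 first.
- by move=> y _; exact: integral_ge0.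
- exact: measurable_integral_slice1.
- by rewrite ltW// pd_det_gt0.
apply: eq_integral => y _; rewrite (ih S (c' + (a^-1 * (y - c0)) *: b)%R)//.
  by congr (_ * _); apply: eq_integral => t _; rewrite /g2 LkE.
exact: measurable_Rd_slice1.
Qed.

End integral_on_Rd.

(** * Hyperplanes are null, cubes have positive measure *)

Section null_and_positive.
Variable R : realType.
Local Notation T := (measurableTypeR R).
Local Notation mu := (@lebesgue_measure R).
Local Open Scope ereal_scope.

(* The integral of a nonnegative function is a supremum over simple functions,
   so that monotonicity requires no measurability. *)
Lemma le_integral_Rd d (g f : 'cV[R]_d -> \bar R) :
  (forall x, 0 <= g x) -> (forall x, g x <= f x) -> integral_Rd g <= integral_Rd f.
Proof.
move=> g0 gf; have f0 x : 0 <= f x by exact: le_trans (gf x).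
rewrite /integral_Rd !ge0_integralTE//.
apply: le_ereal_sup => _ [h hg <-]; exists h => // x.
exact: le_trans (hg x) (gf _).
Qed.

Lemma integral_Rd_ge0 d (g : 'cV[R]_d -> \bar R) :
  (forall x, 0 <= g x) -> 0 <= integral_Rd g.
Proof. by move=> g0; apply: integral_ge0. Qed.

Lemma measurable_dotv d (c : 'cV[R]_d) :
  measurable_fun [set: d.-tuple T] (fun t : d.-tuple T => dotv c (colt t)).
Proof.
rewrite (_ : (fun _ => _) = fun t : d.-tuple T => (\sum_i c i ord0 * tnth t i)%R).
  apply: measurable_sum => i; apply: measurable_funM => //; exact: measurable_tnth.
by apply/funext => t; rewrite dotvE; apply: eq_bigr => i _; rewrite mxE.
Qed.

(** The value [+oo] makes it dominate every function supported on the hyperplane. *)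
Definition hyperplane_inf d (c : 'cV[R]_d) (k : R) (x : 'cV[R]_d) : \bar R :=
  if dotv c x == k then +oo else 0.

Lemma hyperplane_inf_ge0 d (c : 'cV[R]_d) k x : 0 <= hyperplane_inf c k x.
Proof. by rewrite /hyperplane_inf; case: ifP. Qed.

Lemma measurable_hyperplane_inf d (c : 'cV[R]_d) k :
  measurable_Rd (hyperplane_inf c k).
Proof.
apply: measurable_fun_ifT => //.
by apply: measurable_fun_eqr => //; exact: measurable_dotv.
Qed.

Lemma dotv_col_mx d (c0 x0 : R) (c x : 'cV[R]_d) :
  dotv (col_mx c0%:M c : 'cV[R]_(1 + d))%R (col_mx x0%:M x)%R = (c0 * x0 + dotv c x)%R.
Proof.
rewrite /dotv tr_col_mx mul_row_col mxE tr_scalar_mx -scalar_mxM mxE eqxx.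
by rewrite mulr1n.
Qed.

(** If the tail [c'] of [c] is nonzero, fixing the first coordinate leaves a hyperplane of one
    dimension less. If it is zero, the hyperplane fixes the first coordinate, and each line in that
    direction meets it in one point. *)
Lemma integral_hyperplane d (c : 'cV[R]_d) k : c != 0%R ->
  integral_Rd (hyperplane_inf c k) = 0.
Proof.
elim: d c k => [c k /eqP[]|d ih c k c_neq0]; first by apply/colP => -[].
have mh := measurable_hyperplane_inf c k.
have [c0 [c' cE]] := col_mx_scalarP (c : 'cV[R]_(1 + d)).
have hE x (t : 'cV[R]_d) : hyperplane_inf c k (col_mx x%:M t : 'cV[R]_(1 + d))%R =
    hyperplane_inf c' (k - c0 * x)%R t.
  by rewrite /hyperplane_inf cE dotv_col_mx -[in RHS]subr_eq opprK addrC.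
have [c'0|c'0] := eqVneq c' 0%R; last first.
  rewrite (integral_Rd_cons1 mh); last by move=> x; exact: hyperplane_inf_ge0.
  rewrite integral0_eq// => x _; rewrite -[RHS](ih c' (k - c0 * x)%R c'0).
  by apply: eq_integral => t _; rewrite hE.
rewrite (integral_Rd_cons2 mh); last by move=> x; exact: hyperplane_inf_ge0.
rewrite integral0_eq// => t _.
have c00 : c0 != 0%R.
  apply: contra c_neq0 => /eqP c00; rewrite cE c00 c'0.
  by rewrite raddf0 col_mx0.
transitivity (\int[mu]_(x in [set (k / c0)%R]) (+oo : \bar R)).
  rewrite [RHS]integral_mkcond; apply: eq_integral => x _.
  rewrite hE /hyperplane_inf c'0 /dotv trmx0 mul0mx mxE patchE.
  have -> // : (x \in [set (k / c0)%R]) = (0%R == k - c0 * x)%R.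
  apply/idP/idP => [/set_mem/= ->|]; first by rewrite mulrC divfK// subrr.
  rewrite eq_sym subr_eq0 => /eqP ->; apply/mem_set => /=.
  by rewrite mulrAC divff// mul1r.
by rewrite null_set_integral//; exact: lebesgue_measure_set1.
Qed.

Lemma integral_Rd_hyperplane d (c : 'cV[R]_d) k (f : 'cV[R]_d -> \bar R) :
  c != 0%R -> (forall x, 0 <= f x) -> (forall x, f x != 0 -> dotv c x = k) ->
  integral_Rd f = 0.
Proof.
move=> c0 f0 fH; apply/eqP; rewrite eq_le integral_Rd_ge0// andbT.
rewrite -(integral_hyperplane k c0); apply: le_integral_Rd => // x.
rewrite /hyperplane_inf; have [->|/fH ->] := eqVneq (f x) 0.
  by case: ifP.
by rewrite eqxx leey.
Qed.

(** Written as a product so that the integral factors over the coordinates. *)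
Definition cube_indic d (e : R) (x : 'cV[R]_d) : \bar R :=
  (\prod_i \1_(`[- e, e]) (x i ord0))%:E.

Lemma cube_indic_ge0 d e (x : 'cV[R]_d) : 0 <= cube_indic e x.
Proof. by rewrite lee_fin prodr_ge0. Qed.

Lemma measurable_cube_indic d e : measurable_Rd (@cube_indic d e).
Proof.
apply/measurable_EFinP; apply: measurable_prod => i _.
rewrite (_ : (fun _ => _) =
  fun t : d.-tuple T => (\1_(`[- e, e]) (tnth t i))%R); last first.
  by apply/funext => t; rewrite mxE.
by apply: measurableT_comp => //; exact: measurable_tnth.
Qed.

Lemma integral_cube_gt0 d (e : R) : (0 < e)%R -> 0 < integral_Rd (@cube_indic d e).
Proof.
move=> e0; elim: d => [|d ih].
  by rewrite integral_Rd0 /cube_indic big_ord0 lte_fin.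
rewrite (integral_Rd_cons1 (@measurable_cube_indic d.+1 e)); last exact: cube_indic_ge0.
have sliceE x (t : 'cV[R]_d) : cube_indic e (col_mx x%:M t : 'cV[R]_(1 + d))%R =
    (\1_(`[- e, e]) x)%:E * cube_indic e t.
  have x0E : col_mx x%:M t (ord0 : 'I_(1 + d)) ord0 = x.
    rewrite mxE; case: split_ordP => j; last by move/(congr1 val).
    by rewrite ord1 mxE eqxx.
  have eS i : col_mx x%:M t (lift ord0 i : 'I_(1 + d)) ord0 = t i ord0.
    by rewrite -[RHS](col_mxEd x%:M); congr (col_mx _ _ _ _); exact: val_inj.
  rewrite /cube_indic -EFinM (big_ord_recl d) x0E.
  congr (_ * _)%:E; apply: eq_bigr => i _; congr (\1_ _ _); exact: eS.
have -> : \int[mu]_x integral_Rd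
     (fun t : 'cV[R]_d => cube_indic e (col_mx x%:M t : 'cV[R]_(1 + d))%R) =
   \int[mu]_x (integral_Rd (@cube_indic d e) * (\1_(`[- e, e] : set T) x)%:E).
  apply: eq_integral => x _; rewrite muleC /integral_Rd.
  rewrite -ge0_integralZl_EFin//; last 2 first.
  - by move=> t _; exact: cube_indic_ge0.
  - exact: measurable_cube_indic.
  by apply: eq_integral => t _; rewrite sliceE.
rewrite ge0_integralZl//; last 2 first.
- by apply/measurable_EFinP; exact: measurable_indic.
- exact: ltW.
rewrite mule_gt0// integral_indic// setIT.
have := @lebesgue_measure_itv R `[(- e)%R, e]; rewrite /= lte_fin gtrN// => ->.
by rewrite -EFinB lte_fin opprK addr_gt0.
Qed.

End null_and_positive.

(** * Ellipsoids in terms of shape, height and center *)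

Section profile.
Variables (R : realType) (d : nat) (s : R).
Hypothesis s_gt0 : 0 < s.
Local Notation T := (measurableTypeR R).
Implicit Types (v a x : 'cV[R]_d) (A : 'M[R]_d) (f : 'cV[R]_d -> R).

(* The [s]-th power of the height over [v] of the unit ball; it is [0] outside
   of the ball since [Num.sqrt] vanishes on negative numbers. *)
Definition profile v : R := Num.sqrt (1 - normsq v) `^ s.

Lemma profile_ge0 v : 0 <= profile v. Proof. exact: powR_ge0. Qed.

Lemma profile0 : profile 0 = 1.
Proof. by rewrite /profile (eqP (_ : normsq _ == 0)) ?normsq_eq0// subr0 sqrtr1 powR1. Qed.

Lemma profile_le v w : normsq v <= normsq w -> profile w <= profile v.
Proof.
move=> vw; apply: ge0_ler_powR; rewrite ?nnegrE ?sqrtr_ge0//; first exact: ltW.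
by rewrite ler_wsqrtr// lerD2l lerN2.
Qed.

Lemma profile_le1 v : profile v <= 1.
Proof.
rewrite -profile0 profile_le//.
by rewrite (eqP (_ : normsq (0 : 'cV[R]_d) == 0)) ?normsq_eq0// normsq_ge0.
Qed.

Lemma profile_out v : 1 <= normsq v -> profile v = 0.
Proof.
by move=> v1; rewrite /profile ler0_sqrtr ?subr_le0// powR0// gt_eqF.
Qed.

Lemma measurable_profile : measurable_Rd (fun v => (profile v)%:E).
Proof.
apply/measurable_EFinP.
apply: (measurableT_comp (measurable_powR s)).
have msqrt : measurable_fun [set: R] (@Num.sqrt R).
  by apply: continuous_measurable_fun => x; exact: sqrt_continuous.
apply: (measurableT_comp msqrt); apply: measurable_funB => //.
apply: measurable_sum => i; apply: measurable_funX.
rewrite (_ : (fun _ => _) = fun t : d.-tuple T => tnth t i); first exact: measurable_tnth.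
by apply/funext => t; rewrite mxE.
Qed.

Definition kappa : \bar R := integral_Rd (fun v => (profile v)%:E).

Lemma kappa_gt0 : (0 < kappa)%E.
Proof.
(* On the cube of half-side [e] one has [normsq x <= d * e ^+ 2 <= 4^-1], so the height of the ball
   there is at least [2^-1]. Using [d.+1] keeps [e] positive when [d = 0]. *)
pose e : R := (2 * d.+1%:R)^-1.
have e0 : 0 < e by rewrite invr_gt0 mulr_gt0.
pose k : R := 2^-1 `^ s; have k0 : 0 < k by exact: powR_gt0.
have : (0 < k%:E * integral_Rd (@cube_indic R d e))%E.
  by rewrite mule_gt0 ?lte_fin// integral_cube_gt0.
move=> /lt_le_trans; apply; rewrite /integral_Rd.
rewrite -ge0_integralZl_EFin//; last 3 first.
- by move=> t _; exact: cube_indic_ge0.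
- exact: measurable_cube_indic.
- exact: ltW.
apply: (@le_integral_Rd _ _ (fun x => k%:E * cube_indic e x)%E) => x.
  by rewrite mule_ge0 ?cube_indic_ge0// lee_fin ltW.
rewrite -EFinM lee_fin.
have [xe|/existsNP[i xi]] := pselect (forall i, `|x i ord0| <= e); last first.
  rewrite (bigD1 i)//= indicE memNset ?mul0r ?mulr0 ?profile_ge0//=.
  by rewrite in_itv/= -ler_norml.
rewrite big1 ?mulr1 => [|i _]; last first.
  by rewrite indicE mem_set//= in_itv/= -ler_norml.
apply: ge0_ler_powR; rewrite ?nnegrE ?sqrtr_ge0//; first exact: ltW.
rewrite -[2^-1](@ger0_norm R)// -sqrtr_sqr ler_wsqrtr//.
have xe2 : normsq x <= \sum_(i < d) e ^+ 2.
  apply: ler_sum => i _; rewrite -[x i ord0 ^+ 2]real_normK ?num_real//.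
  by rewrite ler_pXn2r// ?nnegrE// ltW.
have : \sum_(i < d) e ^+ 2 <= 4^-1.
  rewrite sumr_const card_ord -[_ *+ d]mulr_natl /e.
  have d0 : 0 < d.+1%:R :> R by [].
  have dd : d%:R <= d.+1%:R :> R by rewrite ler_nat.
  have d1 : 1 <= d.+1%:R :> R by rewrite ler1n.
  rewrite exprVn ler_pdivrMr ?exprn_gt0 ?mulr_gt0//.
  move: d1 dd; set D := d.+1%:R; set x' := d%:R; nra.
move=> /(le_trans xe2) h; have -> : 2^-1 ^+ 2 = 4^-1 :> R by field.
lra.
Qed.

(* [b] stands for the [s]-th power of the height of the ellipsoid. *)
Definition contained f A (b : R) a := forall v, b * profile v <= f (A *m v + a).

Lemma ellipsoidP A (alpha : R) a x (xi : R) : A \in unitmx -> 0 < alpha ->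
  dsym_ellipsoid_of A alpha a (col_mx x xi%:M) <->
  normsq (invmx A *m (x - a)) + (xi / alpha) ^+ 2 <= 1.
Proof.
move=> uA al0.
have ballE (u : 'cV[R]_d) (w : R) :
    @euclidean_ball R (d + 1) (col_mx u w%:M) = (normsq u + w ^+ 2 <= 1) :> Prop.
  rewrite /euclidean_ball/= big_split_ord/= big_ord1.
  by under eq_bigr do rewrite col_mxEu; rewrite col_mxEd mxE eqxx mulr1n.
have imE (u : 'cV[R]_d) (w : R) :
    block_mx A 0 0 alpha%:M *m col_mx u w%:M + col_mx a 0 =
    col_mx (A *m u + a) (alpha * w)%:M.
  by rewrite mul_block_col !mul0mx addr0 add0r add_col_mx addr0 -scalar_mxM.
split.
  move=> [u]; rewrite -(vsubmxK u) (scalar_mx11 (dsubmx u)) ballE imE.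
  move: (usubmx u) (dsubmx u 0 0) => {u} u w uB.
  move=> /eq_col_mx[<- /(congr1 (fun M : 'M[R]_1 => M 0 0))].
  rewrite !mxE eqxx !mulr1n => <-.
  by rewrite addrK mulKmx// mulrAC divff ?gt_eqF// mul1r.
move=> h; exists (col_mx (invmx A *m (x - a)) (xi / alpha)%:M); first by rewrite ballE.
by rewrite imE mulKVmx// subrK mulrC divfK ?gt_eqF.
Qed.

(** Off the projection of the ellipsoid the fiber is empty and [Num.sqrt] of a negative number is
    [0], so a single formula covers all [x]. *)
Lemma half_fiber A (alpha : R) a x : A \in unitmx -> 0 < alpha ->
  ((2^-1)%:E * lebesgue_measure (fiber (dsym_ellipsoid_of A alpha a) x))%E =
  (alpha * Num.sqrt (1 - normsq (invmx A *m (x - a))))%:E.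
Proof.
move=> uA al0; set n := normsq _.
have fE : fiber (dsym_ellipsoid_of A alpha a) x =
    [set xi | n + (xi / alpha) ^+ 2 <= 1].
  by apply/funext => xi; apply/propext; exact: ellipsoidP.
rewrite fE; have [n1|n1] := lerP n 1; last first.
  rewrite (_ : [set _ | _] = set0); last first.
    apply/seteqP; split=> // xi /=; have := sqr_ge0 (xi / alpha); lra.
  by rewrite measure0 mule0 ltr0_sqrtr ?subr_lt0// mulr0.
set h := alpha * _.
have h0 : 0 <= h by rewrite mulr_ge0 ?sqrtr_ge0// ltW.
rewrite (_ : [set _ | _] = `[- h, h]%classic); last first.
  apply/funext => xi; rewrite /= in_itv/= -ler_norml -lerBrDl.
  rewrite -(@ler_sqrt _ _ (1 - n)) ?subr_ge0// sqrtr_sqr normrM normfV (gtr0_norm al0).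
  by rewrite ler_pdivrMr// mulrC.
have := @lebesgue_measure_itv R `[- h, h]; rewrite /= lte_fin => ->.
rewrite -EFinB opprK; case: ltP => [_|hh].
  by rewrite -EFinM; congr EFin; field.
by rewrite mule0; congr EFin; lra.
Qed.

Lemma svolume_ellipsoid A (alpha : R) a : positive_definite A -> 0 < alpha ->
  svolume s (dsym_ellipsoid_of A alpha a) = ((alpha `^ s * \det A)%:E * kappa)%E.
Proof.
move=> pA al0; have uA := pd_unitmx pA.
pose g x : \bar R := (alpha `^ s * profile (invmx A *m (x - a)))%:E.
have mg : measurable_Rd g.
  have mp := measurable_Rd_affine (invmx A) (- (invmx A *m a)) measurable_profile.
  rewrite /measurable_Rd (_ : (fun _ => _) = fun t : d.-tuple T =>
    ((alpha `^ s)%:E * (profile (invmx A *m colt t - invmx A *m a))%:E)%E).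
    exact: measurable_funeM mp.
  by apply/funext => t; rewrite /g mulmxBr EFinM.
transitivity (integral_Rd g).
  apply: eq_integral => t _; rewrite half_fiber// poweR_EFin powRM ?sqrtr_ge0//.
  exact: ltW.
rewrite (integral_Rd_affine a pA mg) => [|x]; last first.
  by rewrite lee_fin mulr_ge0 ?powR_ge0// profile_ge0.
rewrite mulrC EFinM -muleA; congr (_ * _)%E.
transitivity (\int[lebesgue R d]_t ((alpha `^ s)%:E * (profile (colt t))%:E))%E.
  by apply: eq_integral => t _; rewrite /g addrK mulKmx// EFinM.
rewrite ge0_integralZl_EFin; [by []|by []| | |exact: powR_ge0].
  by move=> t _; rewrite lee_fin profile_ge0.
exact: measurable_profile.
Qed.

Lemma sub_lifting f A (alpha : R) a : (forall x, 0 <= f x) ->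
  positive_definite A -> 0 < alpha ->
  dsym_ellipsoid_of A alpha a `<=` lifting s f <-> contained f A (alpha `^ s) a.
Proof.
move=> f0 pA al0; have uA := pd_unitmx pA.
have powP (w y : R) : 0 <= w -> 0 <= y -> (w <= y `^ s^-1) = (w `^ s <= y).
  move=> w0 y0; apply/idP/idP => h.
    have := ge0_ler_powR (ltW s_gt0) w0 (powR_ge0 _ _) h.
    by rewrite -powRrM mulVf ?gt_eqF// powRr1.
  have si : 0 <= s^-1 by rewrite invr_ge0 ltW.
  have := ge0_ler_powR si (powR_ge0 _ _) y0 h.
  by rewrite -powRrM mulfV ?gt_eqF// powRr1.
split=> [sub v|con z].
  have [v1|/ltW v1] := lerP (normsq v) 1; last by rewrite profile_out// mulr0.
  (* The topmost point of the ellipsoid over [A *m v + a]. *)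
  have := sub (col_mx (A *m v + a) (alpha * Num.sqrt (1 - normsq v))%:M).
  rewrite (ellipsoidP _ _ _ uA al0) addrK mulKmx// mulrAC divff ?gt_eqF// mul1r.
  rewrite sqr_sqrtr ?subr_ge0// addrC subrK => /(_ (lexx _)).
  rewrite /lifting/= col_mxKu col_mxKd mxE eqxx mulr1n.
  rewrite ger0_norm ?mulr_ge0 ?sqrtr_ge0 ?(ltW al0)//.
  by rewrite powP ?mulr_ge0 ?sqrtr_ge0 ?(ltW al0)// powRM ?sqrtr_ge0// ltW.
rewrite -(vsubmxK z) (scalar_mx11 (dsubmx z)).
set x := usubmx z; set xi := dsubmx z 0 0.
rewrite (ellipsoidP _ _ _ uA al0) /lifting/= col_mxKu col_mxKd mxE eqxx mulr1n => h.
rewrite powP//; have := con (invmx A *m (x - a)); rewrite mulKVmx// subrK.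
apply: le_trans; rewrite /profile -powRM ?sqrtr_ge0 ?(ltW al0)//.
apply: ge0_ler_powR; rewrite ?nnegrE ?mulr_ge0 ?sqrtr_ge0 ?(ltW al0) ?(ltW s_gt0)//.
rewrite -ler_pdivrMl// mulrC -(gtr0_norm al0) -normfV -normrM -sqrtr_sqr ler_wsqrtr//.
by rewrite lerBrDl.
Qed.

End profile.

Section log_concave_functions.
Variables (R : realType) (d : nat).
Implicit Types (f : 'cV[R]_d -> R).

Lemma log_concave_ge0 f x : log_concave f -> 0 <= f x.
Proof. by move=> [psi _ fE]; rewrite -lee_fin fE expeR_ge0. Qed.

Lemma expeR_neq0P (y : R) (e : \bar R) : y%:E = expeR (- e)%E -> e != -oo%E ->
  y != 0 -> exists2 p, e = p%:E & y = expR (- p).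
Proof.
case: e => [p|/=|//]; first by case=> ye _; exists p.
by case=> ->; rewrite eqxx.
Qed.

Lemma log_concave_quasi f x y t : log_concave f -> 0 <= t <= 1 ->
  Num.min (f x) (f y) <= f (t *: x + (1 - t) *: y).
Proof.
move=> lf /andP[t0 t1]; have f0 z := log_concave_ge0 z lf.
case: lf => psi [psiN psiC] fE.
have [x0|x0] := eqVneq (f x) 0; first by rewrite x0 min_l.
have [y0|y0] := eqVneq (f y) 0; first by rewrite y0 min_r.
have [p px fx] := expeR_neq0P (fE x) (psiN x) x0.
have [q qy fy] := expeR_neq0P (fE y) (psiN y) y0.
have := psiC x y t; rewrite t0 t1 px qy => /(_ isT).
rewrite -!EFinM -EFinD => le_psi.
rewrite -lee_fin fE.
apply: (@le_trans _ _ (expR (- (t * p + (1 - t) * q)))%:E); last first.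
  by rewrite -[leLHS]/(expeR (- _)%:E) ler_expeR EFinN leeN2.
rewrite lee_fin fx fy ge_min !ler_expR.
have [pq|/ltW qp] := lerP p q; apply/orP; [right|left]; nra.
Qed.

Lemma log_concave_mid f x y : log_concave f ->
  f x * f y <= f (2^-1 *: (x + y)) ^+ 2.
Proof.
move=> lf; have f0 z := log_concave_ge0 z lf.
case: lf => psi [psiN psiC] fE.
have [x0|x0] := eqVneq (f x) 0; first by rewrite x0 mul0r sqr_ge0.
have [y0|y0] := eqVneq (f y) 0; first by rewrite y0 mulr0 sqr_ge0.
have [p px fx] := expeR_neq0P (fE x) (psiN x) x0.
have [q qy fy] := expeR_neq0P (fE y) (psiN y) y0.
have h2 : 1 - 2^-1 = 2^-1 :> R by field.
have := psiC x y 2^-1.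
rewrite h2 -scalerDr px qy invr_ge0 ler0n invf_le1// ler1n => /(_ isT).
rewrite -!EFinM -EFinD => le_psi.
have le_f : expR (- (2^-1 * p + 2^-1 * q)) <= f (2^-1 *: (x + y)).
  rewrite -lee_fin fE -[leLHS]/(expeR (- _)%:E) ler_expeR EFinN leeN2//.
apply: (@le_trans _ _ (expR (- (2^-1 * p + 2^-1 * q)) ^+ 2)).
  rewrite fx fy -expRD expr2 -expRD ler_expR; lra.
by rewrite ler_pXn2r// nnegrE ?expR_ge0.
Qed.

End log_concave_functions.

Section cauchy_schwarz.
Variables (R : realType) (d : nat).
Implicit Types (A : 'M[R]_d) (x y : 'cV[R]_d).

Lemma psd_cauchy_schwarz A x y : A^T = A -> (forall z, 0 <= quad A z) ->
  (x^T *m A *m y) 0 0 ^+ 2 <= quad A x * quad A y.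
Proof.
move=> sA pA; set B := (x^T *m A *m y) 0 0.
have yx : (y^T *m A *m x) 0 0 = B.
  rewrite /B.
  have <- : (y^T *m A *m x)^T = x^T *m A *m y by rewrite !trmx_mul trmxK sA mulmxA.
  by rewrite [RHS]mxE.
have q t u : quad A (t *: x + u *: y) =
    t ^+ 2 * quad A x + 2 * t * u * B + u ^+ 2 * quad A y.
  have mxD (M M' : 'M[R]_1) : (M + M') 0 0 = M 0 0 + M' 0 0 by rewrite mxE.
  have mxZ k (M : 'M[R]_1) : (k *: M) 0 0 = k * M 0 0 by rewrite mxE.
  rewrite /quad.
  have -> : (t *: x + u *: y)^T = t *: x^T + u *: y^T by rewrite linearD !linearZ.
  rewrite !(mulmxDl, mulmxDr) -!(scalemxAl, scalemxAr) !mxD !mxZ yx -/B; ring.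
have Qx := pA x; have := pA y; rewrite le_eqVlt => /predU1P[Qy|Qy].
  (* As the form vanishes at [y], its value at this combination is [- B ^+ 2]. *)
  have := pA (B *: x + (- (quad A x + 1) / 2) *: y); rewrite q -Qy => h.
  have : B ^+ 2 * -1 >= 0 by move: h; nra.
  rewrite mulr0; lra.
have := pA (quad A y *: x + (- B) *: y); rewrite q => h.
have : 0 <= quad A y * (quad A x * quad A y - B ^+ 2) by move: h; nra.
by rewrite pmulr_rge0// subr_ge0.
Qed.

Lemma cauchy_schwarz x y : dotv x y ^+ 2 <= normsq x * normsq y.
Proof.
have e z : quad (1%:M : 'M[R]_d) z = normsq z by rewrite quad_scalar mul1r.
have := @psd_cauchy_schwarz 1%:M x y (tr_scalar_mx _ _).
rewrite mulmx1 !e; apply => z; rewrite e; exact: normsq_ge0.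
Qed.

End cauchy_schwarz.

(** * Means and stretchings of contained ellipsoids; uniqueness *)

Section contained_ellipsoids.
Variables (R : realType) (d : nat) (s : R).
Hypothesis s_gt0 : 0 < s.
Variable f : 'cV[R]_d -> R.
Hypothesis f_lc : log_concave f.
Implicit Types (A : 'M[R]_d) (a b c : 'cV[R]_d) (p : R).
Local Notation contained := (contained s f).

(** Both inclusions are used at the same [v], so the profile factors out as a square and midpoint
    log-concavity averages only the heights. *)
Lemma contained_mid A1 A2 p1 p2 a1 a2 : 0 <= p1 -> 0 <= p2 ->
  contained A1 p1 a1 -> contained A2 p2 a2 ->
  contained (2^-1 *: (A1 + A2)) (Num.sqrt (p1 * p2)) (2^-1 *: (a1 + a2)).
Proof.
move=> p10 p20 c1 c2 v; set x := _ + _.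
have -> : x = 2^-1 *: ((A1 *m v + a1) + (A2 *m v + a2)).
  by rewrite /x -scalemxAl -scalerDr mulmxDl addrACA.
set y := A1 *m v + a1; set z := A2 *m v + a2.
rewrite -(@ler_pXn2r _ 2)// ?nnegrE ?mulr_ge0 ?sqrtr_ge0 ?profile_ge0 ?log_concave_ge0//.
apply: le_trans (log_concave_mid y z f_lc).
rewrite exprMn sqr_sqrtr ?mulr_ge0// expr2 mulrACA.
by apply: ler_pM; rewrite ?mulr_ge0 ?profile_ge0.
Qed.

(** The new shape moves the image of [v] by a multiple of [b], with coefficient dotv b v / |b|. By
    Cauchy-Schwarz it lies in [-1, 1] when |v| < 1; elsewhere the profile vanishes. *)
Lemma contained_stretch A p c b : 0 <= p -> b != 0 ->
  (forall v t, -1 <= t <= 1 -> p * profile s v <= f (A *m v + c + t *: b)) ->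
  contained (A + (Num.sqrt (normsq b))^-1 *: (b *m b^T)) p c.
Proof.
move=> p0 b0 h v.
have [v1|v1] := lerP 1 (normsq v); first by rewrite profile_out// mulr0 log_concave_ge0.
set n := Num.sqrt _; have n0 : 0 < n by rewrite sqrtr_gt0 normsq_gt0.
have -> : (A + n^-1 *: (b *m b^T)) *m v + c = A *m v + c + (n^-1 * dotv b v) *: b.
  rewrite mulmxDl -scalemxAl -mulmxA (scalar_mx11 (b^T *m v)) mul_mx_scalar.
  by rewrite scalerA addrAC.
apply: h; rewrite -ler_norml normrM normfV (gtr0_norm n0) ler_pdivrMl// mulr1.
rewrite -sqrtr_sqr ler_wsqrtr// (le_trans (cauchy_schwarz b v))//.
by rewrite ler_piMr ?normsq_ge0// ltW.
Qed.

(* [p * \det A] is the [s]-volume of the ellipsoid divided by [kappa]. *)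
Lemma maximal_unique A1 p1 a1 A2 p2 a2 :
  positive_definite A1 -> 0 < p1 -> contained A1 p1 a1 ->
  positive_definite A2 -> 0 < p2 -> contained A2 p2 a2 ->
  (forall A p a, positive_definite A -> 0 < p -> contained A p a ->
     p * \det A <= p1 * \det A1) ->
  p1 * \det A1 = p2 * \det A2 ->
  [/\ A1 = A2, p1 = p2 & a1 = a2].
Proof.
move=> pA1 p10 c1 pA2 p20 c2 mx e.
have d1 := pd_det_gt0 pA1; have d2 := pd_det_gt0 pA2.
have [dM eM] := det_mid pA1 pA2.
have cM := contained_mid (ltW p10) (ltW p20) c1 c2.
have pM := pd_mid pA1 pA2.
have sp0 : 0 < Num.sqrt (p1 * p2) by rewrite sqrtr_gt0 mulr_gt0.
(* Maximality bounds the mean by the common volume, whose square is [p1 * p2 * (\det A1 * \det A2)];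
   this is the converse of the inequality of [det_mid]. *)
have AA : A1 = A2.
  apply: eM; apply/eqP; rewrite eq_le dM/=.
  have h := mx _ _ _ pM sp0 cM; have dM0 := pd_det_gt0 pM.
  have : (Num.sqrt (p1 * p2) * \det (2^-1 *: (A1 + A2))) ^+ 2 <= (p1 * \det A1) ^+ 2.
    by rewrite ler_pXn2r// nnegrE mulr_ge0// ltW.
  have p12 : 0 < p1 * p2 by rewrite mulr_gt0.
  rewrite exprMn (sqr_sqrtr (ltW p12)) [(p1 * _) ^+ 2]expr2.
  by rewrite [X in _ <= _ * X -> _]e [p1 * \det A1 * _]mulrACA ler_pM2l.
subst A2; have pp : p1 = p2 by apply: (mulIf _ e); rewrite gt_eqF.
subst p2; split=> //; apply/eqP; apply: contraT => a12.
pose b := 2^-1 *: (a1 - a2); pose c := 2^-1 *: (a1 + a2).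
have b0 : b != 0 by rewrite scaler_eq0 negb_or invr_eq0 pnatr_eq0/= subr_eq0.
have cc : contained (A1 + (Num.sqrt (normsq b))^-1 *: (b *m b^T)) p1 c.
  apply: contained_stretch => //; first exact: ltW.
  move=> v t t1; pose u := (1 + t) / 2.
  have -> : A1 *m v + c + t *: b = u *: (A1 *m v + a1) + (1 - u) *: (A1 *m v + a2).
    apply/colP => i; move: (A1 *m v) => w; rewrite /u /b /c !mxE.
    by field.
  apply: le_trans (log_concave_quasi _ _ f_lc _); last first.
    by move: t1 => /andP[]; rewrite /u => *; apply/andP; split; lra.
  by rewrite le_min c1 c2.
have n0 : 0 < (Num.sqrt (normsq b))^-1 by rewrite invr_gt0 sqrtr_gt0 normsq_gt0.
have := mx _ _ _ (pd_add_outer b pA1 (ltW n0)) p10 cc.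
by rewrite ler_pM2l// leNgt det_add_outer.
Qed.

End contained_ellipsoids.

(** * A ball on which the function is bounded below *)

Section positive_on_ball.
Variables (R : realType) (d : nat) (s : R).
Variable f : 'cV[R]_d -> R.
Hypothesis f_lc : log_concave f.
Hypothesis f_int : (0 < integral_Rd (fun x => (f x)%:E))%E.

Let f0 x : 0 <= f x. Proof. exact: log_concave_ge0. Qed.

(* A family of differences of maximal rank has full rank: otherwise the support
   of [f] would lie in a hyperplane, which is a null set. *)
Lemma support_spans x0 : f x0 != 0 ->
  exists m (M : 'M[R]_(m, d)), row_full M /\ forall i, f (x0 + (row i M)^T) != 0.
Proof.
move=> fx0.
pose P r := `[< exists m (M : 'M[R]_(m, d)),
  (forall i, f (x0 + (row i M)^T) != 0) /\ \rank M = r >].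
have P0 : exists r, P r.
  exists 0%N; apply/asboolP; exists 0%N, 0; split; first by case.
  exact: mxrank0.
have Pd r : P r -> (r <= d)%N.
  by move=> /asboolP[m [M [_ <-]]]; exact: rank_leq_col.
case: (ex_maxnP P0 Pd) => r /asboolP[m [M [MD rM]]] rmax.
exists m, M; split=> //; rewrite -cokermx_eq0; apply/negP => /negP K0.
(* A nonzero column of the cokernel is orthogonal to the rows of [M]: it is the normal of the
   hyperplane. Any further support point, appended as a row, cannot raise the rank, so its
   difference is orthogonal too. *)
have [j cj] : exists j, col j (cokermx M) != 0.
  apply/existsP; apply: contraNT K0; rewrite negb_exists => /forallP h.
  apply/eqP/matrixP => i j; have /negPn/eqP/colP/(_ i) := h j.
  by rewrite !mxE.
suff : integral_Rd (fun x => (f x)%:E) = 0%E by move=> e; move: f_int; rewrite e ltxx.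
apply: (@integral_Rd_hyperplane _ _ (col j (cokermx M))
  (dotv (col j (cokermx M)) x0)) => //.
move=> x; rewrite eqe => fx.
pose N := col_mx M (x - x0)^T.
have rN : (\rank N <= r)%N.
  apply: rmax; apply/asboolP; exists (m + 1)%N, N; split=> // i.
  case: (split_ordP i) => k ->; first by rewrite /N rowKu.
  rewrite /N rowKd (_ : row k _ = (x - x0)^T) ?trmxK ?subrKC//.
  by apply/rowP => l; rewrite !mxE ord1.
have MN : (M <= N)%MS by rewrite -addsmxE addsmxSl.
have NM : (N <= M)%MS.
  by have [_ <-] := mxrank_leqif_sup MN; rewrite eqn_leq (mxrankS MN) rM rN.
have : ((x - x0)^T <= M)%MS by apply: submx_trans NM; rewrite -addsmxE addsmxSr.
rewrite submxE => /eqP /matrixP /(_ 0 j); rewrite [RHS]mxE => e.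
apply/eqP; rewrite -subr_eq0; apply/eqP.
rewrite !dotvE -sumrB -[RHS]e mxE; apply: eq_bigr => i _.
by rewrite !mxE -mulrBr mulrC.
Qed.

(** The missing weight goes to the point [0]. A bound [p] in place of [1] lets the induction
    continue with [p - w ord0], without renormalizing the other weights. *)
Lemma convex_combination m (K : set 'cV[R]_d) (u : 'I_m -> 'cV[R]_d) (w : 'I_m -> R) p :
  (forall x y t, K x -> K y -> 0 <= t <= 1 -> K (t *: x + (1 - t) *: y)) ->
  K 0 -> (forall i, K (u i)) -> (forall i, 0 <= w i) -> \sum_i w i <= p ->
  exists2 k, K k & \sum_i w i *: u i = p *: k.
Proof.
move=> cK K0; elim: m u w p => [|m ih] u w p Ku w0 wp.
  by exists 0 => //; rewrite big_ord0 scaler0.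
have [|||k Kk kE] := ih (fun i => u (lift ord0 i)) (fun i => w (lift ord0 i)) (p - w ord0).
- by move=> i; exact: Ku.
- by move=> i; exact: w0.
- by rewrite lerBrDl -big_ord_recl.
have w0p : w ord0 <= p.
  by apply: le_trans wp; rewrite big_ord_recl lerDl sumr_ge0.
have p0 : 0 <= p by exact: le_trans w0p.
rewrite big_ord_recl kE.
have [pe|pn] := eqVneq p 0.
  exists 0 => //; have -> : w ord0 = 0 by apply/eqP; rewrite eq_le w0 -pe w0p.
  by rewrite pe subr0 !scale0r addr0.
exists ((w ord0 / p) *: u ord0 + (1 - w ord0 / p) *: k).
  apply: cK => //; rewrite divr_ge0//= ler_pdivrMr ?mul1r//.
  by rewrite lt_neqAle eq_sym pn.
rewrite scalerDr !scalerA mulrC divfK//; congr (_ + _ *: _).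
by field.
Qed.

(** The superlevel set of the minimum [p] of [f] over [x0] and the points [x0 + (row i M)^T] is
    convex. These points affinely span the space, so it contains a ball around their barycenter. *)
Lemma positive_on_ball : exists x0 r p, [/\ 0 < r, 0 < p &
  forall x, normsq x <= 1 -> p <= f (r *: x + x0)].
Proof.
have [x0 fx0] : exists x0, f x0 != 0.
  apply: contrapT => /forallNP h; move: f_int.
  rewrite (_ : (fun x => _) = fun=> 0%E); last first.
    by apply/funext => x; have /negP/negPn/eqP -> := h x.
  by rewrite /integral_Rd integral0 ltxx.
have [m [M [fM MD]]] := support_spans fx0.
have fx0_gt0 : 0 < f x0 by rewrite lt_neqAle eq_sym fx0 f0.
have [p p0 [px0 pM]] : exists2 p, 0 < p & p <= f x0 /\ forall i, p <= f (x0 + (row i M)^T).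
  have MD0 i : 0 < f (x0 + (row i M)^T) by rewrite lt_neqAle eq_sym MD f0.
  exists (\big[Num.min/f x0]_i f (x0 + (row i M)^T)).
    by apply: lt_bigmin.
  by split=> [|i]; [exact: bigmin_le_id|exact: bigmin_le].
pose Q := pinvmx M.
pose B := 1 + \sum_j \sum_i `|Q j i|.
have B0 : 0 < B by rewrite ltr_pwDl// sumr_ge0// => j _; rewrite sumr_ge0.
(* [B] bounds the sum of the absolute coefficients of a unit vector in the rows of [M]. With this
   radius they perturb the weights [n] without making one negative, and the total stays at most
   [n * m + n = 1]. *)
pose r := (m.+1%:R * B)^-1; have r0 : 0 < r by rewrite invr_gt0 mulr_gt0.
pose n : R := m.+1%:R^-1.
have n0 : 0 < n by rewrite invr_gt0.
exists (x0 + \sum_i n *: (row i M)^T), r, p; split=> // x x1.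
pose c : 'rV[R]_m := x^T *m Q.
have xE : x = \sum_i c 0 i *: (row i M)^T.
  have : x^T = c *m M by rewrite mulmxKpV// submx_full.
  move/(congr1 trmx); rewrite trmxK => ->.
  by rewrite mulmx_sum_row linear_sum; apply: eq_bigr => i _; rewrite linearZ.
have xj j : `|x j 0| <= 1.
  rewrite -(@ler_pXn2r _ 2)// ?nnegrE// expr1n real_normK ?num_real//.
  apply: le_trans x1; rewrite /normsq (bigD1 j)//= lerDl sumr_ge0// => i _.
  exact: sqr_ge0.
have cB : \sum_i `|c 0 i| <= B.
  apply: (@le_trans _ _ (\sum_i \sum_j `|Q j i|)); last by rewrite exchange_big/= lerDr.
  apply: ler_sum => i _; rewrite mxE; apply: le_trans (ler_norm_sum _ _ _) _.
  by apply: ler_sum => j _; rewrite normrM mxE ler_piMl.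
have rc i : r * `|c 0 i| <= n.
  have : `|c 0 i| <= B.
    by apply: le_trans cB; rewrite (bigD1 i)//= lerDl sumr_ge0.
  by move=> h; rewrite /r /n invfM -mulrA ler_piMr ?invr_ge0// mulrC ler_pdivrMr// mul1r.
pose K : set 'cV[R]_d := [set y | p <= f (x0 + y)].
have cK y z t : K y -> K z -> 0 <= t <= 1 -> K (t *: y + (1 - t) *: z).
  move=> Ky Kz t01; rewrite /K/=.
  have -> : x0 + (t *: y + (1 - t) *: z) = t *: (x0 + y) + (1 - t) *: (x0 + z).
    by apply/colP => i; rewrite !mxE; ring.
  by apply: le_trans (log_concave_quasi _ _ f_lc t01); rewrite le_min Ky Kz.
have [||||k Kk kE] := @convex_combination m K (fun i => (row i M)^T)
    (fun i => n + r * c 0 i) 1 cK.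
- by rewrite /K/= addr0.
- by move=> i; exact: pM.
- move=> i; have := rc i; have := ler_norm (- c 0 i); rewrite normrN.
  by move=> h1 h2; rewrite -lerBlDr sub0r (le_trans _ h2)// -mulrN ler_pM2l.
- rewrite big_split/= sumr_const card_ord -mulr_sumr.
  have : r * \sum_i c 0 i <= n.
    apply: (@le_trans _ _ (r * B)); last by rewrite /r invfM divfK// gt_eqF.
    by rewrite ler_pM2l// (le_trans _ cB)// ler_sum// => i _; exact: ler_norm.
  have : n *+ m + n = 1 by rewrite -mulrSr -mulr_natl /n divff.
  lra.
have -> : r *: x + (x0 + \sum_i n *: (row i M)^T) = x0 + k.
  rewrite -[k]scale1r -kE addrCA; congr (_ + _).
  rewrite {1}xE scaler_sumr -big_split; apply: eq_bigr => i _ /=.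
  by rewrite scalerA -scalerDl addrC.
exact: Kk.
Qed.

End positive_on_ball.

(** * Bounds on contained ellipsoids of volume at least that of a ball *)

Section a_priori_bounds.
Variables (R : realType) (d : nat) (s : R).
Hypothesis s_gt0 : 0 < s.
Variable f : 'cV[R]_d -> R.
Hypothesis f_lc : log_concave f.
Variable C : R.
Hypothesis vol_le : forall (A : 'M[R]_d) p a, positive_definite A -> 0 < p ->
  contained s f A p a -> p * \det A <= C.
Variables (r p0 : R) (a0 : 'cV[R]_d).
Hypotheses (r_gt0 : 0 < r) (p0_gt0 : 0 < p0) (c0 : contained s f r%:M p0 a0).
Implicit Types (A : 'M[R]_d) (a b c : 'cV[R]_d) (p : R).

(* The comparison with the ball, via the mean of the two ellipsoids. *)
Lemma mid_vol_le A p a : positive_definite A -> 0 < p -> contained s f A p a ->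
  p0 * p * \det (2^-1 *: (A + r%:M)) ^+ 2 <= C ^+ 2.
Proof.
move=> pA p_gt0 cA; have pr := pd_scalar d r_gt0.
have pM := pd_mid pA pr.
have pp : 0 < p * p0 by rewrite mulr_gt0.
have sp0 : 0 < Num.sqrt (p * p0) by rewrite sqrtr_gt0.
have := vol_le pM sp0 (contained_mid f_lc (ltW p_gt0) (ltW p0_gt0) cA c0).
have dM := pd_det_gt0 pM => h.
rewrite [p0 * p]mulrC -(sqr_sqrtr (ltW pp)) -exprMn.
have h0 : 0 <= Num.sqrt (p * p0) * \det (2^-1 *: (A + r%:M)) by rewrite mulr_ge0// ltW.
by rewrite ler_pXn2r// nnegrE (le_trans h0).
Qed.

Let V0 := p0 * r ^+ d.

Let V0_gt0 : 0 < V0. Proof. by rewrite mulr_gt0// exprn_gt0. Qed.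

Lemma quad_half_add A B x : quad (2^-1 *: (A + B)) x = 2^-1 * quad A x + 2^-1 * quad B x.
Proof. by rewrite quad_mid; field. Qed.

Let C_gt0 : 0 < C.
Proof.
apply: lt_le_trans V0_gt0 _; rewrite /V0 -det_scalar.
exact: vol_le (pd_scalar d r_gt0) p0_gt0 c0.
Qed.

(** Multiply [mid_vol_le] by [p]: the left side becomes [p0] times the square of p det((A + r)/2),
    which is at least 2^-d p det A >= 2^-d V0, while the right side is [p * C ^+ 2]. *)
Lemma height_ge : exists2 q, 0 < q & forall A p a,
  positive_definite A -> 0 < p -> contained s f A p a -> V0 <= p * \det A -> q <= p.
Proof.
exists (p0 * (2^-1 ^+ d * V0) ^+ 2 / C ^+ 2).
  by rewrite divr_gt0 ?mulr_gt0 ?exprn_gt0 ?mulr_gt0 ?exprn_gt0 ?invr_gt0.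
move=> A p a pA p_gt0 cA VA.
have pr := pd_scalar d r_gt0; have pM := pd_mid pA pr.
have D : 2^-1 ^+ d * \det A <= \det (2^-1 *: (A + r%:M)).
  rewrite -detZ; have p2A : positive_definite (2^-1 *: A).
    have [sA qA] := pA; split; first by rewrite linearZ/= sA.
    by move=> x x0; rewrite -/(quad _ x) quadZ mulr_gt0 ?invr_gt0//; exact: qA.
  have [sM _] := pM.
  apply: (det_le p2A sM _).1 => x.
  by rewrite quad_half_add quadZ lerDl mulr_ge0 ?invr_ge0//; exact: quad_pd.
have h := mid_vol_le pA p_gt0 cA.
rewrite ler_pdivrMr ?exprn_gt0//.
have dA := pd_det_gt0 pA.
have e0 : 0 < 2^-1 ^+ d :> R by rewrite exprn_gt0 ?invr_gt0.
have h1 : (2^-1 ^+ d * V0) ^+ 2 <= (p * \det (2^-1 *: (A + r%:M))) ^+ 2.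
  rewrite ler_pXn2r ?nnegrE; last 3 first.
  - by [].
  - by rewrite mulr_ge0// ltW.
  - by rewrite mulr_ge0// ltW// pd_det_gt0.
  apply: (@le_trans _ _ (2^-1 ^+ d * (p * \det A))); first by rewrite ler_pM2l.
  by rewrite mulrCA ler_pM2l.
apply: (@le_trans _ _ (p0 * (p * \det (2^-1 *: (A + r%:M))) ^+ 2)).
  by rewrite ler_pM2l.
apply: (@le_trans _ _ (p * (p0 * p * \det (2^-1 *: (A + r%:M)) ^+ 2))).
  by rewrite exprMn; rewrite le_eqVlt; apply/orP; left; apply/eqP; ring.
by rewrite ler_pM2l.
Qed.

(** Dropping [A] from the mean shape leaves det >= (r/2)^d, so [mid_vol_le] bounds [p] directly. *)
Lemma height_le : exists B, forall A p a,
  positive_definite A -> 0 < p -> contained s f A p a -> p <= B.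
Proof.
pose e : R := (2^-1 * r) ^+ d; have e0 : 0 < e by rewrite exprn_gt0 ?mulr_gt0 ?invr_gt0.
exists (C ^+ 2 / (p0 * e ^+ 2)) => A p a pA p_gt0 cA.
have pr := pd_scalar d r_gt0; have pM := pd_mid pA pr.
have D : e <= \det (2^-1 *: (A + r%:M)).
  rewrite /e -det_scalar; have p2r : positive_definite ((2^-1 * r)%:M : 'M[R]_d).
    by apply: pd_scalar; rewrite mulr_gt0 ?invr_gt0.
  have [sM _] := pM; apply: (det_le p2r sM _).1 => x.
  rewrite quad_half_add -scale_scalar_mx quadZ lerDr mulr_ge0 ?invr_ge0//.
  exact: quad_pd.
rewrite ler_pdivlMr; last exact: mulr_gt0 p0_gt0 (exprn_gt0 2 e0).
apply: le_trans (mid_vol_le pA p_gt0 cA).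
rewrite mulrCA mulrA ler_pM2l ?mulr_gt0// ler_pXn2r ?nnegrE ?(ltW e0)//.
exact/ltW/pd_det_gt0.
Qed.

Lemma quad_delta A i j :
  ((delta_mx i 0 : 'cV[R]_d)^T *m A *m (delta_mx j 0 : 'cV[R]_d)) 0 0 = A i j.
Proof. by rewrite trmx_delta -rowE -colE !mxE. Qed.

(** Let u be the i-th column of A. By Cauchy-Schwarz A dominates u u^T / A_ii, so (A + r)/2
    dominates a rank-one perturbation of r/2 with determinant at least (r/2)^d (1 + A_ii / r). As
    the height is at least [q], [mid_vol_le] bounds A_ii; off-diagonal entries follow by
    Cauchy-Schwarz. *)
Lemma entries_le : exists B, forall A p a, positive_definite A -> 0 < p ->
  contained s f A p a -> V0 <= p * \det A -> forall i j, `|A i j| <= B.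
Proof.
have [q q0 hq] := height_ge.
pose e : R := (2^-1 * r) ^+ d; have e0 : 0 < e by rewrite exprn_gt0 ?mulr_gt0 ?invr_gt0.
pose B := r * (C ^+ 2 / (p0 * q * e ^+ 2)).
exists B => A p a pA p_gt0 cA VA.
have [sA _] := pA.
have diag_gt0 i : 0 < A i i.
  rewrite -(quad_delta A) ; apply: (proj2 pA).
  by apply/eqP => /colP /(_ i); rewrite !mxE !eqxx => /eqP; rewrite oner_eq0.
have diag_le i : A i i <= B.
  pose u := col i A.
  have uE x : dotv u x = ((delta_mx i 0 : 'cV[R]_d)^T *m A *m x) 0 0.
    by rewrite /dotv /u trmx_delta -rowE tr_col sA.
  have p2r : 0 < 2^-1 * r by rewrite mulr_gt0 ?invr_gt0.
  pose t := (2 * A i i)^-1; have t0 : 0 < t by rewrite invr_gt0 mulr_gt0.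
  have pr := pd_scalar d r_gt0; have pM := pd_mid pA pr.
  have D : e * (1 + A i i / r) <= \det (2^-1 *: (A + r%:M)).
    apply: (@le_trans _ _ (\det ((2^-1 * r)%:M + t *: (u *m u^T)))).
      rewrite det_scalar_outer ?gt_eqF// ler_pM2l// lerD2l.
      have : A i i ^+ 2 <= normsq u.
        by rewrite /normsq (bigD1 i)//= mxE lerDl sumr_ge0// => j _; exact: sqr_ge0.
      rewrite -(@ler_pM2l _ (t / (2^-1 * r))) ?divr_gt0//; apply: le_trans.
      by rewrite le_eqVlt; apply/orP; left; apply/eqP; rewrite /t; field; rewrite !gt_eqF.
    apply: (det_le (pd_add_outer u (pd_scalar d p2r) (ltW t0)) (proj1 pM) _).1 => x.
    rewrite quad_half_add [X in _ <= X]addrC quadD quadZ quad_outer.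
    rewrite -scale_scalar_mx quadZ lerD2l.
    rewrite uE /t invfM -mulrA ler_pM2l ?invr_gt0// mulrC ler_pdivrMr// mulrC.
    rewrite -(quad_delta A i i) -/(quad A _); apply: psd_cauchy_schwarz => // z.
    exact: quad_pd.
  have h := mid_vol_le pA p_gt0 cA.
  have qp := hq _ _ _ pA p_gt0 cA VA.
  set y := A i i / r in D; have y0 : 0 < y by rewrite divr_gt0.
  have h2 : p0 * q * (e * (1 + y)) ^+ 2 <= C ^+ 2.
    apply: le_trans h; apply: ler_pM.
    - by rewrite mulr_ge0// ltW.
    - exact: sqr_ge0.
    - by rewrite ler_pM2l.
    - rewrite ler_pXn2r ?nnegrE//; first by rewrite mulr_ge0 ?(ltW e0)// addr_ge0// ltW.
      exact/ltW/pd_det_gt0.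
  suff : y <= C ^+ 2 / (p0 * q * e ^+ 2) by rewrite /y ler_pdivrMr// mulrC.
  have pqe : 0 < p0 * q * e ^+ 2 := mulr_gt0 (mulr_gt0 p0_gt0 q0) (exprn_gt0 2 e0).
  rewrite ler_pdivlMr//; apply: le_trans h2.
  rewrite exprMn [leRHS]mulrA [leLHS]mulrC ler_pM2l//; nra.
move=> i j; have : A i j ^+ 2 <= A i i * A j j.
  rewrite -!(quad_delta A) -/(quad A _) -/(quad A _).
  by apply: psd_cauchy_schwarz => // z; exact: quad_pd.
have Bi := diag_le i; have Bj := diag_le j; have i0 := diag_gt0 i; have j0 := diag_gt0 j.
move=> hij; have B0 : 0 < B by exact: lt_le_trans Bi.
rewrite -(@ler_pXn2r _ 2)// ?nnegrE ?(ltW B0)// real_normK ?num_real//.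
apply: le_trans hij _; rewrite expr2; apply: ler_pM => //; exact: ltW.
Qed.

(* The hull of the ball and of the center [a] contains an ellipsoid elongated
   in the direction of [a - a0], of length comparable with that vector. *)
Lemma center_le : exists B, forall A p a, positive_definite A -> 0 < p ->
  contained s f A p a -> V0 <= p * \det A -> forall i, `|a i 0| <= B.
Proof.
have [q q0 hq] := height_ge.
pose m := Num.min p0 q; have m0 : 0 < m by rewrite lt_min p0_gt0.
pose r2 := 2^-1 * r; have r20 : 0 < r2 by rewrite mulr_gt0 ?invr_gt0.
pose e := r2 ^+ d; have e0 : 0 < e by rewrite exprn_gt0.
pose B1 := r2 * (C / (m * e)).
have B10 : 0 <= B1 by rewrite mulr_ge0 ?divr_ge0 ?mulr_ge0 ?ltW.
exists (\sum_i `|a0 i 0| + 4 * B1) => A p a pA p_gt0 cA VA i.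
have qp := hq _ _ _ pA p_gt0 cA VA.
(* With this factor the centers a0 + b + t b, for t in [-1, 1], run from [a0] to the midpoint of
   [a0] and [a]. The ball keeps weight at least 1/2 in the hull, so radius [r2] and height [m] fit
   throughout. *)
pose b := 4^-1 *: (a - a0).
suff nb : Num.sqrt (normsq b) <= B1.
  have bi : `|b i 0| <= B1.
    apply: le_trans nb; rewrite -sqrtr_sqr ler_wsqrtr//.
    by rewrite /normsq (bigD1 i)//= lerDl sumr_ge0// => j _; exact: sqr_ge0.
  have -> : a i 0 = a0 i 0 + 4 * b i 0 by rewrite !mxE; field.
  apply: le_trans (ler_normD _ _) _; apply: lerD.
    by rewrite (bigD1 i)//= lerDl sumr_ge0.
  by rewrite normrM ger0_norm// ler_pM2l.
have [b0|b0] := eqVneq b 0.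
  by rewrite b0 (eqP (_ : normsq _ == 0)) ?normsq_eq0// sqrtr0.
have cs : contained s f (r2%:M + (Num.sqrt (normsq b))^-1 *: (b *m b^T)) m (a0 + b).
  apply: contained_stretch => //; first exact: ltW.
  move=> v t /andP[t1 t2]; pose u := (1 + t) / 4.
  have u0 : 0 <= u by rewrite /u; lra.
  have u1 : u <= 2^-1 by rewrite /u; lra.
  have u10 : 0 < 1 - u by lra.
  pose k := (2 * (1 - u))^-1.
  have k0 : 0 < k by rewrite invr_gt0 mulr_gt0.
  have k1 : k <= 1 by rewrite invf_le1 ?mulr_gt0//; lra.
  have -> : r2%:M *m v + (a0 + b) + t *: b =
      u *: a + (1 - u) *: (r%:M *m (k *: v) + a0).
    rewrite !mul_scalar_mx; apply/colP => j; rewrite !mxE /r2 /k /u.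
    by field; move: u10; rewrite /u; lra.
  apply: le_trans (log_concave_quasi _ _ f_lc _); last by apply/andP; split; lra.
  rewrite le_min; apply/andP; split.
    have := cA 0; rewrite mulmx0 add0r profile0 mulr1; apply: le_trans.
    apply: (@le_trans _ _ (m * 1)); last first.
      by rewrite mulr1 (le_trans _ qp)// ge_min lexx orbT.
    by rewrite ler_pM2l// profile_le1.
  apply: le_trans (c0 (k *: v)); apply: ler_pM; rewrite ?profile_ge0 ?(ltW m0)//.
    by rewrite ge_min lexx.
  apply: profile_le => //.
  have -> : normsq (k *: v) = k ^+ 2 * normsq v.
    by rewrite /normsq mulr_sumr; apply: eq_bigr => j _; rewrite mxE exprMn.
  by rewrite ler_piMl ?normsq_ge0// expr_le1// ltW.
have n0 : 0 < Num.sqrt (normsq b) by rewrite sqrtr_gt0 normsq_gt0.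
have ni0 : 0 <= (Num.sqrt (normsq b))^-1 by rewrite invr_ge0 ltW.
have := vol_le (pd_add_outer b (pd_scalar d r20) ni0) m0 cs.
rewrite det_scalar_outer ?gt_eqF// -{2}(sqr_sqrtr (normsq_ge0 b)) -/e.
set n := Num.sqrt _ in n0 *.
have -> : n^-1 / r2 * n ^+ 2 = n / r2 by field; rewrite !gt_eqF.
rewrite mulrA mulrC -ler_pdivlMr ?mulr_gt0// => h.
rewrite /B1 mulrC -ler_pdivrMr//; lra.
Qed.

Lemma a_priori_bound : exists q B, 0 < q /\ forall A p a,
  positive_definite A -> 0 < p -> contained s f A p a -> V0 <= p * \det A ->
  [/\ q <= p, p <= B, forall i j, `|A i j| <= B & forall i, `|a i 0| <= B].
Proof.
have [q q0 hq] := height_ge; have [B1 h1] := height_le.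
have [B2 h2] := entries_le; have [B3 h3] := center_le.
exists q, (Num.max B1 (Num.max B2 B3)); split=> // A p a pA p_gt0 cA VA; split.
- exact: (hq _ _ _ pA p_gt0 cA VA).
- by rewrite le_max (h1 _ _ _ pA p_gt0 cA).
- by move=> i j; rewrite !le_max (h2 _ _ _ pA p_gt0 cA VA) orbT.
- by move=> i; rewrite !le_max (h3 _ _ _ pA p_gt0 cA VA) !orbT.
Qed.

End a_priori_bounds.

Section closed_conditions.
Variable (R : realType).

Lemma closed_forall (T : topologicalType) (K : Type) (S : K -> set T) :
  (forall k, closed (S k)) -> closed [set x | forall k, S k x].
Proof.
move=> cS; rewrite (_ : [set _ | _] = \bigcap_k S k); first exact: closed_bigI.
by apply/seteqP; split=> x h k //; exact: h.
Qed.

Lemma closed_ge0 (T : topologicalType) (g : T -> R) :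
  continuous g -> closed [set x | 0 <= g x].
Proof.
by move=> cg; apply: (@preimage_closed _ _ g [set y | 0 <= y]) => [x _|];
  [exact: cg|exact: closed_ge].
Qed.

Lemma mx_continuous (T : topologicalType) m n (F : T -> 'M[R]_(m, n)) :
  (forall i j, continuous (fun x => F x i j)) -> continuous F.
Proof.
move=> cF x A [P Px PA].
have : \forall y \near x, forall ij : 'I_m * 'I_n, P ij.1 ij.2 (F y ij.1 ij.2).
  apply: filter_forall => -[i j] /=; exact: (cF i j x _ (Px i j)).
by apply: filterS => y Py; apply: PA => i j; exact: (Py (i, j)).
Qed.

Lemma continuous_sumr (T : topologicalType) (I : Type) (r : seq I) (F : I -> T -> R) :
  (forall i, continuous (F i)) -> continuous (fun x => \sum_(i <- r) F i x).
Proof.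
by move=> cF; apply: continuous_big => //; exact: add_continuous.
Qed.

Lemma continuous_prodr (T : topologicalType) (I : Type) (r : seq I) (F : I -> T -> R) :
  (forall i, continuous (F i)) -> continuous (fun x => \prod_(i <- r) F i x).
Proof.
by move=> cF; apply: continuous_big => //; exact: mul_continuous.
Qed.

Lemma det_continuous (T : topologicalType) n (F : T -> 'M[R]_n) :
  (forall i j, continuous (fun x => F x i j)) -> continuous (fun x => \det (F x)).
Proof.
move=> cF; apply: continuous_sumr => u x.
by apply: cvgM; [exact: cvg_cst|apply: continuous_prodr => i].
Qed.

Lemma quad_continuous (T : topologicalType) n (F : T -> 'M[R]_n) v :
  (forall i j, continuous (fun x => F x i j)) -> continuous (fun x => quad (F x) v).
Proof.
move=> cF; rewrite (_ : (fun _ => _) =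
    (fun x => \sum_i \sum_j v i 0 * F x i j * v j 0)); last first.
  by apply/funext => x; rewrite quadE.
apply: continuous_sumr => i; apply: continuous_sumr => j x.
apply: cvgM; last exact: cvg_cst.
by apply: cvgM; [exact: cvg_cst|exact: cF].
Qed.

Lemma closed_le_usc (T : topologicalType) d (f : 'cV[R]_d -> R) (g : T -> R)
    (F : T -> 'cV[R]_d) :
  upper_semicontinuous f -> continuous g -> continuous F ->
  closed [set x | g x <= f (F x)].
Proof.
move=> uf cg cF; rewrite (_ : [set _ | _] = ~` [set x | f (F x) < g x]); last first.
  by apply/seteqP; split=> x /=; [move=> h; apply/negP; rewrite -leNgt|
    move/negP; rewrite -leNgt].
apply: open_closedC; rewrite openE => x /= fg.
(* A level strictly between the two values separates them on a whole neighborhood. *)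
pose y := (f (F x) + g x) / 2.
have fy : f (F x) < y by rewrite /y; lra.
have yg : y < g x by rewrite /y; lra.
have [V VF Vf] : exists2 V, nbhs (F x) V & forall z, V z -> ((- y)%:E < (- f z)%:E)%E.
  by apply: uf; rewrite lte_fin ltrN2.
have n1 : \forall z \near x, V (F z) by exact: cF.
have n2 : \forall z \near x, y < g z by apply: cvgr_gt yg; exact: cg.
rewrite /interior; near=> z.
have Vz : V (F z) by near: z.
have := Vf _ Vz; rewrite lte_fin ltrN2 => /lt_trans; apply.
by near: z.
Unshelve. all: by end_near. Qed.

End closed_conditions.

(** * Existence of a maximum by compactness *)

Section existence.
Variables (R : realType) (d : nat) (s : R).
Hypothesis s_gt0 : 0 < s.
Variable f : 'cV[R]_d -> R.

(** By Cauchy-Schwarz, a semidefinite form that vanishes at [x] has [x] in its kernel. This recovers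
    definiteness for the maximizer, whose volume is positive. *)
Lemma psd_det_pd (A : 'M[R]_d) : A^T = A -> (forall x, 0 <= quad A x) ->
  \det A != 0 -> positive_definite A.
Proof.
move=> sA qA dA; split=> // x x0; rewrite -/(quad A x) lt_neqAle qA andbT.
apply: contra x0 => /eqP qx.
have Ax : x^T *m A = 0.
  apply/rowP => j; rewrite [RHS]mxE.
  have := psd_cauchy_schwarz x (delta_mx j 0) sA qA.
  by rewrite -qx mul0r real_exprn_even_le0 ?num_real//= -colE !mxE => /eqP.
have uA : A \in unitmx by rewrite unitmxE unitfE.
by rewrite -[x]trmxK -(mulmxK uA x^T) Ax mul0mx trmx0.
Qed.

(** Triples are flattened into one row vector (height, center, shape), so that boundedness and
    closedness give compactness. *)
Let N := (1 + (d + d * d))%N.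

Definition height_of (z : 'rV[R]_N) : R := z 0 (lshift _ 0).
Definition center_of (z : 'rV[R]_N) : 'cV[R]_d :=
  \col_i z 0 (rshift 1 (lshift _ i)).
Definition shape_of (z : 'rV[R]_N) : 'M[R]_d :=
  \matrix_(i, j) z 0 (rshift 1 (rshift d (mxvec_index i j))).
Definition parameters (A : 'M[R]_d) (p : R) (a : 'cV[R]_d) : 'rV[R]_N :=
  row_mx p%:M (row_mx a^T (mxvec A)).

Lemma height_ofK A p a : height_of (parameters A p a) = p.
Proof. by rewrite /height_of row_mxEl mxE eqxx. Qed.

Lemma center_ofK A p a : center_of (parameters A p a) = a.
Proof. by apply/colP => i; rewrite mxE row_mxEr row_mxEl mxE. Qed.

Lemma shape_ofK A p a : shape_of (parameters A p a) = A.
Proof. by apply/matrixP => i j; rewrite mxE row_mxEr row_mxEr mxvecE. Qed.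

Lemma height_of_continuous : continuous height_of.
Proof. exact: coord_continuous. Qed.

Lemma center_of_continuous i : continuous (fun z => center_of z i 0).
Proof.
rewrite (_ : (fun _ => _) = fun z : 'rV[R]_N => z 0 (rshift 1 (lshift _ i))).
  exact: coord_continuous.
by apply/funext => z; rewrite mxE.
Qed.

Lemma shape_of_continuous i j : continuous (fun z => shape_of z i j).
Proof.
rewrite (_ : (fun _ => _) =
    fun z : 'rV[R]_N => z 0 (rshift 1 (rshift d (mxvec_index i j)))).
  exact: coord_continuous.
by apply/funext => z; rewrite mxE.
Qed.

Hypothesis f_lc : log_concave f.
Hypothesis f_usc : upper_semicontinuous f.

Lemma maximum_exists q B A0 p0 a0 : 0 < q ->
  positive_definite A0 -> 0 < p0 -> contained s f A0 p0 a0 ->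
  (forall A p a, positive_definite A -> 0 < p -> contained s f A p a ->
     p0 * \det A0 <= p * \det A ->
     [/\ q <= p, p <= B, forall i j, `|A i j| <= B & forall i, `|a i 0| <= B]) ->
  exists A p a, [/\ positive_definite A, 0 < p, contained s f A p a &
    forall A' p' a', positive_definite A' -> 0 < p' -> contained s f A' p' a' ->
      p' * \det A' <= p * \det A].
Proof.
move=> q0 pA0 p0_gt0 c0 bnd.
(* A closed relaxation: symmetry is a family of weak inequalities over all ordered pairs, shapes are
   only semidefinite, and [0 < p] becomes [q <= p]. *)
pose Theta := [set z : 'rV[R]_N | [/\ (forall ij : 'I_d * 'I_d,
   0 <= shape_of z ij.1 ij.2 - shape_of z ij.2 ij.1),
   (forall x, 0 <= quad (shape_of z) x), 0 <= height_of z - q,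
   contained s f (shape_of z) (height_of z) (center_of z) &
   forall i, 0 <= B - `|z 0 i|]].
have inTheta A p a : positive_definite A -> 0 < p -> contained s f A p a ->
    p0 * \det A0 <= p * \det A -> Theta (parameters A p a).
  move=> pA p_gt0 cA VA; have [qp pB AB aB] := bnd _ _ _ pA p_gt0 cA VA.
  rewrite /Theta/= shape_ofK height_ofK center_ofK; split=> //.
  - by move=> [i j]/=; case: pA => sA _; rewrite -{1}sA mxE subrr.
  - by move=> x; exact: quad_pd.
  - by rewrite subr_ge0.
  - move=> i; rewrite subr_ge0; case: (split_ordP i) => k ->.
      by rewrite row_mxEl mxE ord1 eqxx mulr1n gtr0_norm.
    rewrite row_mxEr; case: (split_ordP k) => l ->.
      by rewrite row_mxEl mxE.
    by rewrite row_mxEr; case/mxvec_indexP: l => i' j'; rewrite mxvecE.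
have Theta0 : Theta !=set0.
  by exists (parameters A0 p0 a0); exact: inTheta.
have closedT : closed Theta.
  rewrite (_ : Theta = [set z | forall ij : 'I_d * 'I_d,
       0 <= shape_of z ij.1 ij.2 - shape_of z ij.2 ij.1] `&`
     ([set z | forall x, 0 <= quad (shape_of z) x] `&`
     ([set z | 0 <= height_of z - q] `&`
     ([set z | contained s f (shape_of z) (height_of z) (center_of z)] `&`
      [set z | forall i, 0 <= B - `|z 0 i|])))); last first.
    by apply/seteqP; split=> [z []|z [? [? [? []]]]].
  apply: closedI; last apply: closedI; last apply: closedI; last apply: closedI.
  - apply: closed_forall => -[i j]; apply: closed_ge0 => z.
    by apply: continuousB; exact: shape_of_continuous.
  - apply: closed_forall => x; apply: closed_ge0; apply: quad_continuous.
    exact: shape_of_continuous.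
  - apply: closed_ge0 => z; apply: continuousB; last exact: cst_continuous.
    exact: height_of_continuous.
  - apply: closed_forall => v.
    apply: (@closed_le_usc _ _ _ _ (fun z => height_of z * profile s v)
      (fun z => shape_of z *m v + center_of z)) => //.
      by move=> z; apply: continuousM; [exact: height_of_continuous|exact: cst_continuous].
    apply: mx_continuous => i j.
    rewrite (_ : (fun _ => _) = fun z =>
      \sum_k shape_of z i k * v k 0 + center_of z i 0); last first.
      by apply/funext => z; rewrite ord1 mxE [X in X + _ = _]mxE.
    move=> z; apply: continuousD; last exact: center_of_continuous.
    apply: continuous_sumr => k y; apply: continuousM; last exact: cst_continuous.
    exact: shape_of_continuous.
  - apply: closed_forall => i; apply: closed_ge0 => z.
    apply: (continuousB (f := fun=> B) (g := fun z : 'rV[R]_N => `|z 0 i|)).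
      exact: cst_continuous.
    by apply: continuous_comp; [exact: coord_continuous|exact: norm_continuous].
have boundT : bounded_set Theta.
  exists B; split; first exact: num_real.
  move=> M BM z [_ _ _ _ zB].
  have zM i : `|z 0 i| <= M.
    by have := zB i; rewrite subr_ge0 => /le_trans; apply; exact: ltW.
  have M0 : 0 <= M by exact: le_trans (zM (lshift _ 0)).
  rewrite /Num.norm/= mx_normrE; apply: bigmax_le => // -[i j] _ /=.
  by rewrite ord1.
have cT := bounded_closed_compact boundT closedT.
have cV : {within Theta, continuous (fun z => height_of z * \det (shape_of z))}.
  apply: continuous_subspaceT => z; apply: continuousM; first exact: height_of_continuous.
  by apply: det_continuous; exact: shape_of_continuous.
have [z /set_mem Tz zmax] := EVT_max_rV Theta0 cT cV.
have ge0 : p0 * \det A0 <= height_of z * \det (shape_of z).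
  have := zmax (parameters A0 p0 a0); rewrite shape_ofK height_ofK; apply.
  by apply/mem_set/inTheta.
have [symz qz hz cz _] := Tz.
have h0 : 0 < height_of z by move: hz; rewrite subr_ge0; exact: lt_le_trans.
have dz : \det (shape_of z) != 0.
  apply/eqP => dz; move: ge0; rewrite dz mulr0 leNgt mulr_gt0//.
  exact: pd_det_gt0.
exists (shape_of z), (height_of z), (center_of z); split=> //.
  apply: psd_det_pd => //; apply/matrixP => i j; rewrite mxE.
  by apply/eqP; rewrite eq_le -subr_ge0 (symz (i, j)) -subr_ge0 (symz (j, i)).
move=> A p a pA p_gt0 cA.
(* A competitor below the initial volume may lie outside [Theta], but the maximum is at least that
   volume. *)
have [VA|/ltW VA] := lerP (p0 * \det A0) (p * \det A).
  have := zmax (parameters A p a); rewrite shape_ofK height_ofK; apply.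
  exact/mem_set/inTheta.
exact: le_trans ge0.
Qed.

End existence.

Section volume_bound.
Variables (R : realType) (d : nat) (s : R).
Hypothesis s_gt0 : 0 < s.
Variable f : 'cV[R]_d -> R.

Lemma powRK p : 0 <= p -> (p `^ s^-1) `^ s = p.
Proof. by move=> p0; rewrite -powRrM mulVf ?gt_eqF// powRr1. Qed.

(** With alpha = p^(1/s), the integrand of the [s]-volume at [x] is
    [p * profile s (invmx A *m (x - a))], and containment says that it is at most [f x]. *)
Lemma contained_integral_le A p a : positive_definite A -> 0 < p ->
  contained s f A p a ->
  ((p * \det A)%:E * kappa d s <= integral_Rd (fun x => (f x)%:E))%E.
Proof.
move=> pA p_gt0 cA; have uA := pd_unitmx pA.
pose alpha := p `^ s^-1; have al0 : 0 < alpha by exact: powR_gt0.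
rewrite -[p]powRK ?(ltW p_gt0)// -(svolume_ellipsoid s a pA al0).
have e x : (((2^-1)%:E * lebesgue_measure (fiber (dsym_ellipsoid_of A alpha a) x)) `^ s
    = (p * profile s (invmx A *m (x - a)))%:E)%E.
  rewrite half_fiber// poweR_EFin powRM ?sqrtr_ge0 ?(ltW al0)//.
  by rewrite powRK// ltW.
apply: le_integral_Rd => x; rewrite e lee_fin.
  by rewrite mulr_ge0 ?profile_ge0// ltW.
by have := cA (invmx A *m (x - a)); rewrite mulKVmx// subrK.
Qed.

End volume_bound.

Theorem theorem4p1 (R : realType) (d : nat) (s : R) (f : 'cV[R]_d -> R)
    (s_gt0 : 0 < s) (f_proper : proper_log_concave f) :
  exists! E : set 'cV[R]_(d + 1), John_ellipsoid s f E.
Proof.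
have [f_lc f_usc /andP[int_gt0 int_fin]] := f_proper.
have f0 x : 0 <= f x by exact: log_concave_ge0.
have [a0 [r [p0 [r0 p0_gt0 ball]]]] := positive_on_ball f_lc int_gt0.
have c0 : contained s f r%:M p0 a0.
  move=> v; have [v1|/ltW v1] := lerP (normsq v) 1; last first.
    by rewrite profile_out// mulr0.
  rewrite mul_scalar_mx; apply: le_trans (ball v v1).
  by rewrite ler_piMr ?profile_le1// ltW.
have pr := pd_scalar d r0.
have kappa_pos := kappa_gt0 d s_gt0.
have V0 : 0 < p0 * \det (r%:M : 'M[R]_d) by rewrite mulr_gt0 ?pd_det_gt0.
(* If [kappa] were infinite, the contained ball would give [f] an infinite integral. *)
have kappa_fin : kappa d s \is a fin_num.
  rewrite ge0_fin_numE ?ltW// ltNge; apply/negP; rewrite leye_eq => /eqP kE.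
  have := contained_integral_le s_gt0 pr p0_gt0 c0.
  by rewrite kE gt0_muley ?lte_fin// leye_eq => /eqP e; rewrite e ltxx in int_fin.
have [k kE] : exists k, kappa d s = k%:E by exists (fine (kappa d s)); rewrite fineK.
have k0 : 0 < k by rewrite -lte_fin -kE.
have [I IE] : exists I, integral_Rd (fun x => (f x)%:E) = I%:E.
  exists (fine (integral_Rd (fun x => (f x)%:E))).
  by rewrite fineK// ge0_fin_numE// ltW.
have vol_le A p a : positive_definite A -> 0 < p -> contained s f A p a ->
    p * \det A <= I / k.
  move=> pA p_gt0 cA; rewrite ler_pdivlMr// -lee_fin -IE EFinM -kE.
  exact: contained_integral_le.
have [q [B [q0 bnd]]] := a_priori_bound s_gt0 f_lc vol_le r0 p0_gt0 c0.
rewrite -det_scalar in bnd.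
have [A [p [a [pA p_gt0 cA Amax]]]] := maximum_exists f_usc q0 pr p0_gt0 c0 bnd.
pose alpha := p `^ s^-1; have al0 : 0 < alpha by exact: powR_gt0.
have alE : alpha `^ s = p by apply: powRK => //; exact: ltW.
have svolE (A' : 'M[R]_d) al a' : positive_definite A' -> 0 < al ->
    svolume s (dsym_ellipsoid_of A' al a') = (al `^ s * \det A' * k)%:E.
  by move=> pA' al'0; rewrite svolume_ellipsoid// kE.
exists (dsym_ellipsoid_of A alpha a); split.
  split; first by exists A, alpha, a.
    by apply/(sub_lifting s_gt0) => //; rewrite alE.
  move=> E' [A' [al' [a' [pA' al'0 ->]]]] /(sub_lifting s_gt0 a' f0 pA' al'0) cA'.
  rewrite !svolE// lee_fin ler_pM2r// alE.
  by apply: Amax cA' => //; exact: powR_gt0.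
move=> E' [[A' [al' [a' [pA' al'0 ->]]]] sub max'].
have cA' := (sub_lifting s_gt0 a' f0 pA' al'0).1 sub.
have p'0 : 0 < al' `^ s by exact: powR_gt0.
have volE : p * \det A = al' `^ s * \det A'.
  apply/eqP; rewrite eq_le (Amax _ _ _ pA' p'0 cA') andbT.
  have := max' (dsym_ellipsoid_of A alpha a).
  rewrite !svolE// lee_fin ler_pM2r// alE; apply.
    by exists A, alpha, a.
  by apply/(sub_lifting s_gt0) => //; rewrite alE.
have [-> pE ->] := maximal_unique s_gt0 f_lc pA p_gt0 cA pA' p'0 cA' Amax volE.
by rewrite /alpha pE -powRrM mulfV ?gt_eqF// powRr1// ltW.
Qed.
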